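(* Let $\varphi$ be an assignment which, for any last box $\rho$ of a row of $\widetilde\Delta$ and any box $b\ne\rho$ of $\widetilde\Delta$ that is not higher than $\rho$, chooses exactly one pair $\varphi(b,\rho)$ from the set of pairs of boxes $$\{(b,\rho),(l(b),l(\rho)),(l^2(b),l^2(\rho)),\ldots\}.$$ Let $N_\varphi$ be the subspace of $\mathfrak g^0$ consisting of all $Y\in\mathfrak g^0$, with blocks $Y_{ba}$ defined by $Y(E_a)=\sum_{b\in\widetilde\Delta}E_bY_{ba}$, such that the only possibly nonzero matrices $Y_{ba}$ are the following: (1) $Y_{\varphi(b,\rho)}$, if $b$ and $\rho$ are not in the same row of $\widetilde\Delta$; (2) $Y_{\varphi(b,\rho)}$ and $Y_{m(\varphi(b,\rho))}$, if $b$ and $\rho$ are in the same row of $\widetilde\Delta$ and $b\neq\rho$. Moreover, if $b$ is the $k$th box of the row (from the left), then $Y_{\varphi(b,\rho)}$ is symmetric and $Y_{m(\varphi(b,\rho))}=Y_{\varphi(b,\rho)}$ if $k$ is odd, and $Y_{\varphi(b,\rho)}$ is skew-symmetric and $Y_{m(\varphi(b,\rho))}=-Y_{\varphi(b,\rho)}$ if $k$ is even. Then $N_\varphi$ is a normalization condition with respect to $\delta$, i.e. $N_\varphi=\bigoplus_{k\ge0}(N_\varphi\cap\mathfrak g_k)$ and $$\mathfrak g_k=\bigl(\mathfrak u_k(\delta)+[\delta,\mathfrak g_{k+1}]\bigr)\oplus(N_\varphi\cap\mathfrak g_k)\quad\text{for all }k\ge 0,$$ and $N_\varphi$ is invariant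 with respect to the adjoint action of the group $\mathrm{Sym}^{\mathrm{ne}}_{F(\delta)}$ on $\mathfrak g^0$.
   Context: Let $p_1>p_2>\dots>p_s\ge 1$ and $r_1,\dots,r_s\ge1$ be integers. Let $\Delta$ be the Young diagram with $s$ rows (numbered from top to bottom), the $i$th row having $p_i$ boxes, left-aligned. Let $\widetilde\Delta$ be the union of $\Delta$ and its mirror reflection with respect to its left vertical edge; thus the $i$th row of $\widetilde\Delta$ has $2p_i$ boxes. Let $m:\widetilde\Delta\to\widetilde\Delta$ be the mirror reflection, so $\widetilde\Delta=m(\Delta)\sqcup\Delta$ with $m(\Delta)$ on the left. For a box $a$, $r(a)$ and $l(a)$ denote the next box to the right, respectively left, in the same row of $\widetilde\Delta$ (if it exists); sets of pairs of boxes formed with powers of $l$ contain only pairs of existing boxes. The last box of a row is its rightmost box. A box is not higher than $\rho$ if it lies in the same row as $\rho$ or in a lower one (a row with larger index). Put $\varepsilon(a)=-1$ for $a\in\Delta$ and $\varepsilon(a)=1$ for $a\in m(\Delta)$. Let $(V,\sigma)$ be a real symplectic space with a Darboux basis $\{E_a\}_{a\in\widetilde\Delta}$ indexed by $\widetilde\Delta$: for $a$ in the $i$th row, $E_a=(e_a^1,\dots,e_a^{r_i})$ is a tuple of $r_i$ vectors, all these vectors together form a basis of $V$, every vector of $E_a$ is $\sigma$-orthogonal to every vector of $E_b$ if $b\ne m(a)$, and $\sigma(e^i_{m(a)},e^j_a)=\delta_{ij}$ (Kronecker symbol) for $a\in\Delta$. An endomorphism $X$ of $V$ is written in blocks as $X(E_a)=\sum_{b\in\widetilde\Delta}E_bX_{ba}$,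 where for a tuple $E$ and a matrix $M$ the $j$th vector of $EM$ is the linear combination of $E$ with coefficients from the $j$th column of $M$. Then $X\in\mathfrak g:=\mathfrak{sp}(V)$ iff $X_{ab}=-\varepsilon(a)\varepsilon(b)X_{m(b)m(a)}^T$ for all $a,b\in\widetilde\Delta$. $V$ is graded: for a box $a$ in the $j$th column of $\Delta$ ($j\ge1$), $E_a$ has degree $-j$ and $E_{m(a)}$ has degree $j-1$. Let $\mathfrak g_k$ be the space of elements of $\mathfrak g$ of degree $k$, $\mathfrak g^0=\bigoplus_{k\ge0}\mathfrak g_k$, and let $V^j$ be the sum of the components of $V$ of degree $\ge j$. Let $\delta\in\mathfrak g_{-1}$ be given by $\delta(E_a)=\varepsilon(a)E_{r(a)}$ (and $\delta(E_a)=0$ if $a$ is the last box of a row). $\mathfrak u_0(\delta)=\{x\in\mathfrak g_0:[x,\delta]=0\}$ and $\mathfrak u_k(\delta)=\{x\in\mathfrak g_k:[x,\delta]\in\mathfrak u_{k-1}(\delta)\}$ for $k>0$. $F(\delta)$ is the flat curve of flags $t\mapsto\{\exp(t\delta)V^j\}_{j\in\mathbb Z}$, and $\mathrm{Sym}^{\mathrm{ne}}_{F(\delta)}$ is the group of all $A\in\mathrm{Sp}(V)$ with $A\exp(t\delta)V^j=\exp(t\delta)V^j$ for all $t\in\mathbb R$, $j\in\mathbb Z$. For a pair of boxes $(b,a)$, $Y_{(b,a)}$ means $Y_{ba}$, and $m(b,a):=(m(a),m(b))$ is the mirror pair.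
   Formalization: In (1) the mirror blocks Y_{m(φ(b,ρ))} are also allowed to be nonzero; in (2), when both boxes of φ(b,ρ) lie in the same half of the row, the signs in Y_{m(φ(b,ρ))}=±Y_{φ(b,ρ)} are reversed, as membership in sp(V) forces. Literally the claim is false. *)

(* Defs.v *)
From HB Require Import structures.
From mathcomp Require Import all_boot all_order all_algebra.
From mathcomp Require Import boolp classical_sets reals.

Set Implicit Arguments.
Unset Strict Implicit.
Unset Printing Implicit Defensive.

Import Order.TTheory GRing.Theory Num.Theory.
Local Open Scope classical_set_scope.
Local Open Scope ring_scope.

(** * Boxes of the doubled diagram *)

(* Rows are indexed from 0, top to bottom.  Row [i] consists of [2 * p i] boxes
   indexed from 0, left to right: the first [p i] form m(Delta), the last
   [p i] form Delta. *)
Definition box s (p : 'I_s -> nat) := {i : 'I_s & 'I_(2 * p i)}.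

Section Boxes.
Variables (s : nat) (p : 'I_s -> nat).
Implicit Types (a b rho : box p) (i : 'I_s).

Definition mkbox i (x : 'I_(2 * p i)) : box p :=
  Tagged (fun i => 'I_(2 * p i)) x.

Definition brow a : 'I_s := tag a.
Definition pos a : nat := tagged a.

Definition mirror a : box p := mkbox (rev_ord (tagged a)).

Definition in_Delta a : bool := (p (brow a) <= pos a)%N.

(* The column of a box of Delta, counted from 1. *)
Definition column a : nat := ((pos a).+1 - p (brow a))%N.

Definition deg a : int :=
  if in_Delta a then - (column a)%:Z else (column (mirror a))%:Z - 1.

Definition eps (R : pzRingType) a : R := if in_Delta a then -1 else 1.

Definition ord_next n (x : 'I_n) : option 'I_n := insub x.+1.
Definition ord_prev n (x : 'I_n) : option 'I_n :=
  if val x is k.+1 then insub k else None.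

Definition rbox a : option (box p) := omap (@mkbox (tag a)) (ord_next (tagged a)).
Definition lbox a : option (box p) := omap (@mkbox (tag a)) (ord_prev (tagged a)).

(* l^k (a), when it exists. *)
Definition lpow k a : option (box p) := iter k (obind lbox) (Some a).

Definition is_last a : bool := rbox a == None.

Definition not_higher b rho : bool := (brow rho <= brow b)%N.

Definition admissible b rho : bool :=
  [&& is_last rho, b != rho & not_higher b rho].

(* A pair (b, a) is the index of the block Y_{ba}, which maps E_a to E_b. *)
Definition mirror_pair (ba : box p * box p) : box p * box p :=
  (mirror ba.2, mirror ba.1).

(* The values of [phi] at non-admissible arguments are irrelevant. *)
Definition is_assignment (phi : box p -> box p -> box p * box p) : Prop :=
  forall b rho, admissible b rho ->
    exists k, lpow k b = Some (phi b rho).1 /\ lpow k rho = Some (phi b rho).2.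

End Boxes.

(** * Generalities on subspaces, direct sums and endomorphisms *)

Section LinearAlgebra.
Variables (R : realType) (V : vectType R).
Implicit Types (S A B : set 'End(V)) (F : nat -> set 'End(V)).

Definition is_subspace S : Prop :=
  S 0 /\ forall (c : R) x y, S x -> S y -> S (c *: x + y).

Definition addset A B : set 'End(V) := [set x + y | x in A & y in B].

Definition direct_sum2 S A B : Prop := S = addset A B /\ A `&` B = [set 0].

Definition sumset F : set 'End(V) :=
  [set x | exists n (f : nat -> 'End(V)),
     (forall k, F k (f k)) /\ x = \sum_(k < n) f k].

Definition direct_sum S F : Prop :=
  S = sumset F /\
  forall n (f : nat -> 'End(V)), (forall k, F k (f k)) ->
    \sum_(k < n) f k = 0 -> forall k, (k < n)%N -> f k = 0.

Definition lie (x y : 'End(V)) : 'End(V) := ((x \o y) - (y \o x))%VF.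

Definition lfun_pow n (x : 'End(V)) : 'End(V) :=
  iter n (fun y => (x \o y)%VF) \1%VF.

(* The exponential of a nilpotent endomorphism: the terms of the exponential
   series of index >= dim V vanish; see [delta_nilpotent]. *)
Definition exp_nilp (x : 'End(V)) : 'End(V) :=
  \sum_(n < (\dim {:V}).+1) n`!%:R^-1 *: lfun_pow n x.

End LinearAlgebra.

(** * The symplectic space, its grading, and the normalization condition *)

Section Symplectic.
Variables (R : realType) (s : nat) (p r : 'I_s -> nat) (V : vectType R).
Variables (sigma : {skew_symmetric V}).
(* [e a j] is the j-th vector of the tuple E_a. *)
Variable e : forall a : box p, 'I_(r (brow a)) -> V.
Implicit Types (a b c rho : box p).

Definition darboux_basis : Prop :=
  [/\ basis_of {:V}
        [seq e (tagged z) | z : {a : box p & 'I_(r (brow a))}],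
      forall a b, b != mirror a -> forall i j, sigma (e (a := a) i) (e (a := b) j) = 0
    & forall a, in_Delta a -> forall i j : 'I_(r (brow a)),
        sigma (e (a := mirror a) i) (e (a := a) j) = (i == j)%:R].

Definition Espan a : {vspace V} := <<[seq e (a := a) j | j : 'I_(r (brow a))]>>%VS.

Definition Vdeg (d : int) : {vspace V} := (\sum_(a | deg a == d) Espan a)%VS.

(* V^j *)
Definition Vge (j : int) : {vspace V} := (\sum_(a | (j <= deg a)%R) Espan a)%VS.

Definition sp : set 'End(V) :=
  [set X | forall u v, sigma (X u) v + sigma u (X v) = 0].

Definition Sp : set 'End(V) :=
  [set A | forall u v, sigma (A u) (A v) = sigma u v].

Definition g_ (k : int) : set 'End(V) :=
  [set X | sp X /\ forall d : int, (X @: Vdeg d <= Vdeg (d + k))%VS].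

(* g^0 *)
Definition gnonneg : set 'End(V) := sumset (fun k : nat => g_ k%:Z).

Definition is_delta (delta : 'End(V)) : Prop :=
  forall (i : 'I_s) (x : 'I_(2 * p i)) (j : 'I_(r i)),
    delta (e (a := mkbox x) j) =
      if ord_next x is Some y then eps R (mkbox x) *: e (a := mkbox y) j else 0.

Lemma lfun_powSr n (x : 'End(V)) v : lfun_pow n.+1 x v = lfun_pow n x (x v).
Proof.
elim: n => [|n IHn]; first by rewrite /= !lfunE /= lfunE.
by rewrite [LHS]comp_lfunE IHn /= [RHS]comp_lfunE.
Qed.

Lemma lfun_powZ n (t : R) (x : 'End(V)) :
  lfun_pow n (t *: x) = t ^+ n *: lfun_pow n x.
Proof.
elim: n => [|n IHn] /=; first by rewrite scale1r.
by rewrite IHn -comp_lfunZl -comp_lfunZr scalerA exprS.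
Qed.

Lemma delta_nilpotent delta n :
  (forall i, 1 <= r i)%N -> darboux_basis -> is_delta delta ->
  (\dim {:V} <= n)%N -> lfun_pow n delta = 0.
Proof.
move=> hr [/andP[/eqP spanB freeB] _ _] hdelta le_dim.
have powE m i (x : 'I_(2 * p i)) j :
    (2 * p i <= x + m)%N -> lfun_pow m delta (e (a := mkbox x) j) = 0.
  elim: m i x j => [|m IHm] i x j.
    by rewrite addn0 leqNgt ltn_ord.
  move=> le_xm; rewrite lfun_powSr hdelta /ord_next.
  case: insubP => [y _ Dy|_]; last by rewrite linear0.
  by rewrite linearZ /= IHm ?scaler0 // Dy addSnnS.
have le_p i : (2 * p i <= \dim {:V})%N.
  rewrite -spanB (eqnP freeB) size_image.
  pose f (x : 'I_(2 * p i)) : {a : box p & 'I_(r (brow a))} :=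
    Tagged (fun a => 'I_(r (brow a))) (Ordinal (hr i) : 'I_(r (brow (mkbox x)))).
  have injf : injective f.
    by move=> x y /(congr1 (fun z => pos (tag z))) /= /val_inj.
  by rewrite -[leqLHS]card_ord -(card_codom injf) max_card.
apply/lfunP => v; rewrite zero_lfunE.
set S := [seq e (tagged z) | z : {a : box p & 'I_(r (brow a))}] in spanB *.
have vS : v \in <<in_tuple S>>%VS by rewrite spanB memvf.
rewrite (coord_span vS).
rewrite linear_sum big1 // => k _; rewrite linearZ /=.
have: (in_tuple S)`_k \in S by exact: mem_nth.
move=> /mapP[[[i x] j] _ ->].
rewrite /= powE ?scaler0 //.
exact: leq_trans (le_p i) (leq_trans le_dim (leq_addl _ _)).
Qed.

Section Delta.
Variable delta : 'End(V).

Fixpoint u_ (k : nat) : set 'End(V) :=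
  if k is k'.+1 then [set x | g_ k%:Z x /\ u_ k' (lie x delta)]
  else [set x | g_ 0 x /\ lie x delta = 0].

Definition Sym_ne : set 'End(V) :=
  [set A | Sp A /\ forall (t : R) (j : int),
     ((A \o exp_nilp (t *: delta)) @: Vge j = exp_nilp (t *: delta) @: Vge j)%VS].

Definition normalization_condition (N : set 'End(V)) : Prop :=
  [/\ is_subspace N,
      N `<=` gnonneg,
      direct_sum N (fun k : nat => N `&` g_ k%:Z)
    & forall k : nat,
        direct_sum2 (g_ k%:Z)
          (addset (u_ k) [set lie delta y | y in g_ k.+1%:Z]) (N `&` g_ k%:Z)].

(* On the domain Sym_ne the inverse of 'End(V) is a true inverse, since the
   elements of Sp are injective. *)
Definition Ad_invariant (N : set 'End(V)) : Prop :=
  forall A Y, Sym_ne A -> N Y -> N (A \o Y \o A^-1)%VF.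

End Delta.

(* M c a is the block X_{ca}. *)
Definition blocks_of (X : 'End(V))
    (M : forall c a : box p, 'M[R]_(r (brow c), r (brow a))) : Prop :=
  forall a (j : 'I_(r (brow a))),
    X (e (a := a) j) = \sum_c \sum_(i < r (brow c)) M c a i j *: e (a := c) i.

(* The blocks of an element of sp satisfy
   M c a = - eps c * eps a *: (M (mirror a) (mirror c))^T,
   so a block can only vanish together with its mirror block.  Hence the support
   condition is imposed up to [mirror_pair].  In the row condition,
   - eps c * eps a = 1 when a and c lie in different halves of the row, which
   always holds when (c, a) is its own mirror pair; when they lie in the same
   half it is -1, the value forced by the above relation. *)
Definition N_ (phi : box p -> box p -> box p * box p) : set 'End(V) :=
  [set Y | gnonneg Y /\ exists2 M, blocks_of Y M &
    (forall c a, M c a != 0 ->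
       exists b rho, admissible b rho /\
         ((c, a) = phi b rho \/ (c, a) = mirror_pair (phi b rho)))
    /\
    (forall (i : 'I_s) (xb xrho xc xa : 'I_(2 * p i)),
       admissible (mkbox xb) (mkbox xrho) ->
       phi (mkbox xb) (mkbox xrho) = (mkbox xc, mkbox xa) ->
       let c := mkbox xc in let a := mkbox xa in
       let sgn : R := - eps R c * eps R a in
       (* [mkbox xb] is the k-th box of the row for k = xb.+1 *)
       if odd xb.+1 then
         (M c a)^T = M c a /\ M (mirror a) (mirror c) = sgn *: M c a
       else
         (M c a)^T = - M c a /\ M (mirror a) (mirror c) = - sgn *: M c a)].

End Symplectic.

(* Main.v *)
Require Import Defs.
From HB Require Import structures.
From mathcomp Require Import all_boot all_order all_algebra.
From mathcomp Require Import boolp classical_sets reals.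
From mathcomp Require Import zify ring lra.

(* The space V is a representation of sl2 in which delta is the lowering operator,
   the rows of the doubled diagram being its isotypic components.  After rescaling the
   basis, delta shifts every row to the right, so that [delta, Y] has entry
   Y(x-1, y) - Y(x, y+1) in the block of a pair of rows: up to brackets with delta, an
   entry may be moved along its diagonal, and the sums along the diagonals ending at
   the last box of the upper row are the only invariants.  The choice phi(b, rho)
   picks one box pair on every such diagonal, which gives the complement.  In a
   diagonal block the mirror symmetry reverses a diagonal, and forces its sum to be
   symmetric or skew-symmetric.

   A nonnegatively graded space stable under ad delta centralizes delta: by induction
   on the degree it suffices that a nonnegative X commuting with delta is constant on
   the main diagonals of the diagonal blocks and vanishes elsewhere, hence is 0 if it
   is itself a bracket, since the diagonal sums of a bracket vanish.  This gives
   u_k(delta) = 0 for k > 0, and also that a symmetry of the flat curve acts on every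
   row by a constant orthogonal matrix, an action preserving the normal form. *)

Set Implicit Arguments.
Unset Strict Implicit.
Unset Printing Implicit Defensive.

Import Order.TTheory GRing.Theory Num.Theory.
Local Open Scope ring_scope.

Lemma eq_sign (R : pzRingType) m n : odd m = odd n -> (-1) ^+ m = (-1) ^+ n :> R.
Proof. by move=> mn; rewrite -signr_odd mn signr_odd. Qed.

(** * Brackets with a shift, and sums along diagonals *)

Section Diagonals.
Variables (R : nzRingType) (m n : nat).
Implicit Type a : nat -> nat -> R.

(** Blocks are functions on all pairs of naturals, so the borders are cut off by hand: a term that
    leaves the block through the top or the right counts as 0. *)
Definition shift_br a x y : R :=
  (if x is x'.+1 then a x' y else 0) - (if (y.+1 < n)%N then a x y.+1 else 0).

Lemma eq_shift_br a b x y : (x < m)%N -> (y < n)%N ->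
  (forall x y, (x < m)%N -> (y < n)%N -> a x y = b x y) ->
  shift_br a x y = shift_br b x y.
Proof.
move=> ltx lty ab; rewrite /shift_br; congr (_ - _).
  by case: x ltx => // x ltx; rewrite ab // ltnW.
by case: ltnP => // lty1; rewrite ab.
Qed.

Definition diag_sum a x y : R := \sum_(t < (minn x y).+1) a (x - t)%N (y - t)%N.

Lemma diag_sum0l a y : diag_sum a 0 y = a 0%N y.
Proof. by rewrite /diag_sum min0n big_ord1 !subn0. Qed.

Lemma diag_sum0r a x : diag_sum a x 0 = a x 0%N.
Proof. by rewrite /diag_sum minn0 big_ord1 !subn0. Qed.

Lemma diag_sumSS a x y : diag_sum a x.+1 y.+1 = a x.+1 y.+1 + diag_sum a x y.
Proof. by rewrite /diag_sum minnSS big_ord_recl !subn0. Qed.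

Lemma eq_diag_sum a b x y : (x < m)%N -> (y < n)%N ->
  (forall x y, (x < m)%N -> (y < n)%N -> a x y = b x y) ->
  diag_sum a x y = diag_sum b x y.
Proof.
by move=> ltx lty ab; apply: eq_bigr => t _; apply: ab; apply: leq_ltn_trans (leq_subr _ _) _.
Qed.

(** The sum telescopes. As [x <= y], the diagonal starts in row 0, where the bracket has no first
    term; only the second term at (x, y) survives, and it is 0 in the last column. *)
Lemma diag_sum_shift_br a x y : (x <= y)%N -> (y < n)%N ->
  diag_sum (shift_br a) x y = - (if (y.+1 < n)%N then a x y.+1 else 0).
Proof.
elim: x y => [|x IHx] [|y] // lexy lty; rewrite ?diag_sum0l ?diag_sumSS /shift_br ?sub0r //.
by rewrite IHx ?(ltnW lty) // lty addrAC subrr add0r.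
Qed.

(** Negated partial sums along the diagonals, moved one column to the right: a preimage under
    [shift_br] when the diagonal sums ending in the last column vanish. *)
Definition antishift a x y : R := if y is y'.+1 then - diag_sum a x y' else 0.

Lemma shift_br_antishift a x y :
  (forall x, (x < m)%N -> diag_sum a x n.-1 = 0) ->
  (x < m)%N -> (y < n)%N -> shift_br (antishift a) x y = a x y.
Proof.
move=> a0 ltx lty.
(* In the last column the second term is cut off, and the hypothesis says that the diagonal sum
   replacing it is 0. *)
have -> : shift_br (antishift a) x y =
  (if x is x'.+1 then antishift a x' y else 0) + diag_sum a x y.
  rewrite /shift_br /=; case: ltnP => lyn; first by rewrite opprK.
  by have -> : y = n.-1 by [lia]; rewrite a0 // subr0 addr0.
case: x y {ltx lty} => [|x] [|y] /=; rewrite ?diag_sum0l ?diag_sum0r ?add0r //.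
by rewrite diag_sumSS addrC addrK.
Qed.

Section Kernel.
Variable a : nat -> nat -> R.
Hypothesis a0 : forall x y, (x < m)%N -> (y < n)%N -> shift_br a x y = 0.

Lemma shift_br0_diag x y : (x.+1 < m)%N -> (y < n)%N ->
  a x y = if (y.+1 < n)%N then a x.+1 y.+1 else 0.
Proof. by move=> ltx lty; apply/eqP; rewrite -subr_eq0; apply/eqP/(a0 ltx lty). Qed.

(** Going down and right from (x, y), the diagonal leaves through the right border before it reaches
    the bottom, and what lies beyond that border counts as 0. *)
Lemma shift_br0_up x y : (x + (n - y) < m)%N -> (y < n)%N -> a x y = 0.
Proof.
move Dd: (n - y)%N => d; elim: d x y Dd => [|d IHd] x y Dd ltm lty; first by lia.
rewrite shift_br0_diag //; last by lia.
by case: ltnP => // lty1; apply: IHd; lia.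
Qed.

(** Going up and left, the diagonal meets row 0 outside column 0; there the bracket one column to
    the left is minus the entry. *)
Lemma shift_br0_down x y : (x < y)%N -> (x < m)%N -> (y < n)%N -> a x y = 0.
Proof.
elim: x y => [|x IHx] [|y] // ltxy ltx lty.
  have := a0 ltx (ltnW lty); rewrite /shift_br lty sub0r => /eqP.
  by rewrite oppr_eq0 => /eqP.
by have := shift_br0_diag ltx (ltnW lty); rewrite lty => <-; apply: IHx; lia.
Qed.

End Kernel.

(** A telescoping sum; for a square block it is the trace of a commutator. *)
Lemma sum_diag_shift_br a : \sum_(x < n) shift_br a x x = 0.
Proof.
pose g x := if x is x'.+1 then if (x < n)%N then a x' x else 0 else 0.
transitivity (\sum_(0 <= x < n) (g x - g x.+1)).
  rewrite big_mkord; apply: eq_bigr => -[[|x] ltx] _ /=; rewrite /shift_br /= ?ltx //.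
under eq_bigr do rewrite -opprB.
by rewrite sumrN telescope_sumr // subr0 /g; case: (n) => [|k]; rewrite ?ltnn oppr0.
Qed.

End Diagonals.

(** The reflection swaps the two terms of the bracket, which changes the sign; the alternating
    factor restores it. This makes the bracket with [delta] compatible with the mirror relation of
    [sp]. *)
Lemma shift_br_mirror (R : nzRingType) m n c (a : nat -> nat -> R) x y :
  (x < m)%N -> (y < n)%N ->
  shift_br n (fun x y => (-1) ^+ (c + x + y).+1 * a (n - y.+1)%N (m - x.+1)%N) x y =
  (-1) ^+ (c + x + y).+1 * shift_br m a (n - y.+1)%N (m - x.+1)%N.
Proof.
move=> ltx lty; rewrite /shift_br mulrBr addrC; congr (_ + _).
  case: ltnP => lty1; last by rewrite (_ : (n - y.+1)%N = 0%N) ?mulr0 ?oppr0 //; lia.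
  have -> : (n - y.+1)%N = (n - y.+2).+1 by lia.
  by rewrite -mulNr -[- (-1) ^+ _]mulN1r -exprS; congr (_ * _); apply: eq_sign; lia.
have -> : ((m - x.+1).+1 < m)%N = (0 < x)%N by lia.
case: x ltx => [|x] ltx /=; first by rewrite mulr0 oppr0.
have -> : (m - x.+2).+1 = (m - x.+1)%N by lia.
by rewrite -mulNr -[- (-1) ^+ _]mulN1r -exprS; congr (_ * _); apply: eq_sign; lia.
Qed.

(** * Coordinates and matrix entries in the rescaled basis *)

Section Coordinates.
Variables (R : realType) (s : nat) (p r : 'I_s -> nat) (V : vectType R).
Variable e : forall a : box p, 'I_(r (brow a)) -> V.
Hypothesis he : basis_of {:V}
  [seq e (tagged z) | z : {a : box p & 'I_(r (brow a))}].
Implicit Types (X Y : 'End(V)).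

Local Notation L i := (2 * p i)%N.
Local Notation Z := {a : box p & 'I_(r (brow a))}.
Definition box_vec (z : Z) : V := e (tagged z).
Let S : #|{: Z}|.-tuple V := [tuple of map box_vec (enum_tuple {: Z})].

Let S_basis : basis_of {:V} S.
Proof. exact: he. Qed.

Let S_nth z : S`_(enum_rank z) = box_vec z.
Proof. by rewrite (nth_map z) -?cardE // nth_enum_rank. Qed.

Definition box_coord (z : Z) (v : V) : R := coord S (enum_rank z) v.

Lemma box_coord_vec z w : box_coord z (box_vec w) = (z == w)%:R.
Proof.
rewrite /box_coord -[in LHS]S_nth coord_free; last exact: basis_free S_basis.
by rewrite (inj_eq enum_rank_inj) eq_sym.
Qed.

Lemma box_coord_sum v : v = \sum_z box_coord z v *: box_vec z.
Proof.
rewrite {1}(coord_basis S_basis (memvf v)) (reindex enum_rank) /=.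
  by apply: eq_bigr => z _; rewrite S_nth.
exact/onW_bij/enum_rank_bij.
Qed.

Lemma box_vec_hom (h : Z -> V) : exists X : 'End(V), forall z, X (box_vec z) = h z.
Proof.
have [ff Dff] := linear_of_free S [seq h z | z <- enum {: Z}].
exists (linfun ff) => z; rewrite lfunE /= -[in LHS]S_nth -(nth_map _ 0).
  rewrite Dff; first by rewrite (nth_map z) -?cardE // nth_enum_rank.
    exact: basis_free S_basis.
  by rewrite (size_tuple S) size_map -cardE.
by rewrite (size_tuple S).
Qed.

Let zz i (x : 'I_(L i)) (k : 'I_(r i)) : Z :=
  Tagged (fun a => 'I_(r (brow a))) (k : 'I_(r (brow (mkbox x)))).

Let zz_eq i j (x : 'I_(L i)) (y : 'I_(L j)) k l :
  (zz x k == zz y l) = [&& i == j, x == y :> nat & k == l :> nat].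
Proof.
case: (i =P j) => [ij|nij] /=; last first.
  by apply/negP => /eqP/(congr1 (fun z => brow (tag z)))/nij.
case: _ / ij y l => y l; rewrite val_eqE; case: (x =P y) => [<-|nxy] /=.
  by rewrite eq_Tagged.
by apply/negP => /eqP/(congr1 (fun z => pos (tag z)))/val_inj/nxy.
Qed.

Lemma sum_boxes (W : nmodType) (F : Z -> W) :
  \sum_z F z = \sum_i \sum_(x < L i) \sum_(k < r i) F (zz x k).
Proof.
pose G (i : 'I_s) (x : 'I_(2 * p i)) : W := \sum_(k < r i) F (zz x k).
pose H (a : box p) (k : 'I_(r (brow a))) := F (Tagged (fun a => 'I_(r (brow a))) k).
rewrite [RHS](sig_big_dep (fun _ => true) (fun _ _ => true) G) /=.
transitivity (\sum_(a : box p) \sum_(k < r (brow a)) H a k); last first.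
  by apply: eq_bigr => -[i x] _.
rewrite [RHS](sig_big_dep (fun _ => true) (fun _ _ => true) H) /=.
by apply: eq_bigr => -[[i x] k].
Qed.


(* Rescaling the basis by [flip_sign] removes the sign from delta. *)
Definition flip_sign (i : 'I_s) (x : nat) : R := (-1) ^+ (x - p i).

(** Indexed by all naturals and 0 past the end of the row, so that [delta] becomes [x -> x.+1] with
    no exception at the last box. *)
Definition row_vec i (x : nat) (k : 'I_(r i)) : V :=
  if insub x is Some x' then flip_sign i x *: e (a := mkbox x') k else 0.

Definition row_coord i (x : nat) (k : 'I_(r i)) (v : V) : R :=
  if insub x is Some x' then flip_sign i x * box_coord (zz x' k) v else 0.

(** For fixed [k] and [l] this is a scalar function of two positions, to which the results on
    diagonals apply. *)
Definition entry X i j (k : 'I_(r i)) (l : 'I_(r j)) (x y : nat) : R :=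
  row_coord x k (X (row_vec y l)).

Lemma flip_signK i x : flip_sign i x * flip_sign i x = 1.
Proof. by rewrite /flip_sign -expr2 sqrr_sign. Qed.

Lemma row_vecE i (x : 'I_(L i)) k : row_vec x k = flip_sign i x *: e (a := mkbox x) k.
Proof. by rewrite /row_vec valK. Qed.

Lemma vec_rowE i (x : 'I_(L i)) k : e (a := mkbox x) k = flip_sign i x *: row_vec x k.
Proof. by rewrite row_vecE scalerA flip_signK scale1r. Qed.

Lemma row_vec_out i x (k : 'I_(r i)) : (L i <= x)%N -> row_vec x k = 0.
Proof. by move=> le; rewrite /row_vec insubF // ltnNge le. Qed.

Lemma row_coordE i (x : 'I_(L i)) k v :
  row_coord x k v = flip_sign i x * box_coord (zz x k) v.
Proof. by rewrite /row_coord valK. Qed.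

Lemma row_coord_out i x (k : 'I_(r i)) v : (L i <= x)%N -> row_coord x k v = 0.
Proof. by move=> le; rewrite /row_coord insubF // ltnNge le. Qed.

Fact row_coord_is_scalar i x (k : 'I_(r i)) : scalar (row_coord x k).
Proof.
move=> c u v; rewrite /row_coord; case: insub => [y|]; last by rewrite mulr0 addr0.
by rewrite /box_coord linearP /= mulrDr mulrCA.
Qed.
HB.instance Definition _ i x (k : 'I_(r i)) :=
  GRing.isLinear.Build R V R _ (row_coord x k) (row_coord_is_scalar x k).

Lemma row_coord_vec i j x y (k : 'I_(r i)) (l : 'I_(r j)) : (y < L j)%N ->
  row_coord x k (row_vec y l) = [&& i == j, x == y & k == l :> nat]%:R.
Proof.
move=> lty; have [ltx|lex] := ltnP x (L i); last first.
  rewrite row_coord_out //; case: (i =P j) => // ij; subst j.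
  by case: eqP => // xy; subst y; rewrite ltnNge lex in lty.
rewrite -[x]/(val (Ordinal ltx)) -[y]/(val (Ordinal lty)) row_coordE row_vecE.
rewrite /box_coord linearZ /= -/(box_coord _ _) -/(box_vec (zz (Ordinal lty) l)).
rewrite box_coord_vec zz_eq /=.
case: (i =P j) => [ij|_]; last by rewrite !mulr0.
subst j; case: (x =P y) => [xy|_]; last by rewrite !mulr0.
by subst y; rewrite mulrA flip_signK mul1r.
Qed.

Lemma row_coord_sum v :
  v = \sum_i \sum_(x < L i) \sum_(k < r i) row_coord x k v *: row_vec x k.
Proof.
rewrite {1}(box_coord_sum v) sum_boxes; do 3 apply: eq_bigr => ? _.
by rewrite row_coordE row_vecE scalerA mulrAC flip_signK mul1r.
Qed.

Lemma row_vec_ext X Y :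
  (forall i x (k : 'I_(r i)), (x < L i)%N -> X (row_vec x k) = Y (row_vec x k)) -> X = Y.
Proof.
move=> XY; apply/lfunP => v; rewrite (row_coord_sum v) !linear_sum.
apply: eq_bigr => i _; rewrite !linear_sum; apply: eq_bigr => x _.
by rewrite !linear_sum; apply: eq_bigr => k _; rewrite !linearZ /= XY.
Qed.

Lemma row_coord_ext u v :
  (forall i x (k : 'I_(r i)), (x < L i)%N -> row_coord x k u = row_coord x k v) -> u = v.
Proof.
move=> uv; rewrite (row_coord_sum u) (row_coord_sum v).
by apply: eq_bigr => i _; apply: eq_bigr => x _; apply: eq_bigr => k _; rewrite uv.
Qed.

Lemma entry_ext X Y :
  (forall i j k l x y, (x < L i)%N -> (y < L j)%N ->
     entry X (i := i) (j := j) k l x y = entry Y k l x y) -> X = Y.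
Proof. by move=> XY; apply: row_vec_ext => j y l lty; apply: row_coord_ext => i x k ltx; apply: XY. Qed.

Lemma row_vec_hom (h : forall i, nat -> 'I_(r i) -> V) : exists X : 'End(V),
  forall i x k, (x < L i)%N -> X (row_vec x k) = h i x k.
Proof.
have [X DX] := box_vec_hom (fun z =>
  let i := brow (tag z) in flip_sign i (pos (tag z)) *: h i (pos (tag z)) (tagged z)).
exists X => i x k ltx; rewrite -[x]/(val (Ordinal ltx)) row_vecE linearZ /=.
by rewrite -[e _]/(box_vec (zz (Ordinal ltx) k)) DX /= scalerA flip_signK scale1r.
Qed.

Lemma entry_hom (A : forall i j, 'I_(r i) -> 'I_(r j) -> nat -> nat -> R) :
  exists X, forall i j k l x y, (x < L i)%N -> (y < L j)%N ->
    entry X (i := i) (j := j) k l x y = A i j k l x y.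
Proof.
have [X DX] := row_vec_hom (fun j y l =>
  \sum_i \sum_(x < L i) \sum_(k < r i) A i j k l x y *: row_vec x k).
exists X => i j k l x y ltx lty; rewrite /entry DX // linear_sum /= (bigD1 i) //=.
rewrite linear_sum /= (bigD1 (Ordinal ltx)) //= linear_sum /= (bigD1 k) //=.
rewrite linearZ /= row_coord_vec // !eqxx mulr1 !big1 ?addr0 //.
- move=> i' nii'; rewrite linear_sum big1 // => x' _; rewrite linear_sum big1 // => k' _.
  by rewrite linearZ /= row_coord_vec // eq_sym (negPf nii') mulr0.
- move=> x' nxx'; rewrite linear_sum big1 // => k' _.
  by rewrite linearZ /= row_coord_vec // eqxx -val_eqE /= eq_sym in nxx' *; rewrite (negPf nxx') mulr0.
- move=> k' nkk'; rewrite linearZ /= row_coord_vec // !eqxx /=.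
  by rewrite val_eqE eq_sym (negPf nkk') mulr0.
Qed.

Lemma entry_app X i x (k : 'I_(r i)) v : row_coord x k (X v) =
  \sum_j \sum_(y < L j) \sum_(l < r j) row_coord y l v * entry X k l x y.
Proof.
rewrite {1}(row_coord_sum v) !linear_sum; apply: eq_bigr => j _.
rewrite !linear_sum; apply: eq_bigr => y _; rewrite !linear_sum.
by apply: eq_bigr => l _; rewrite !linearZ.
Qed.

Lemma entryP c X Y i j (k : 'I_(r i)) (l : 'I_(r j)) x y :
  entry (c *: X + Y) k l x y = c * entry X k l x y + entry Y k l x y.
Proof. by rewrite /entry add_lfunE scale_lfunE linearP. Qed.

Lemma entry0 i j (k : 'I_(r i)) (l : 'I_(r j)) x y : entry 0 k l x y = 0.
Proof. by rewrite /entry zero_lfunE linear0. Qed.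

Lemma entryN X i j (k : 'I_(r i)) (l : 'I_(r j)) x y :
  entry (- X) k l x y = - entry X k l x y.
Proof. by rewrite /entry opp_lfunE linearN. Qed.

Lemma entryD X Y i j (k : 'I_(r i)) (l : 'I_(r j)) x y :
  entry (X + Y) k l x y = entry X k l x y + entry Y k l x y.
Proof. by rewrite /entry add_lfunE linearD. Qed.

Lemma entry_sum n (F : 'I_n -> 'End(V)) i j (k : 'I_(r i)) (l : 'I_(r j)) x y :
  entry (\sum_(t < n) F t) k l x y = \sum_(t < n) entry (F t) k l x y.
Proof. by rewrite /entry sum_lfunE linear_sum. Qed.

End Coordinates.

(** * The bracket with [delta] and membership in [sp], read off the entries *)

Section Dictionary.
Variables (R : realType) (s : nat) (p r : 'I_s -> nat) (V : vectType R).
Variables (sigma : {skew_symmetric V}).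
Variable e : forall a : box p, 'I_(r (brow a)) -> V.
Hypothesis he : darboux_basis sigma e.
Let hb : basis_of {:V} [seq e (tagged z) | z : {a : box p & 'I_(r (brow a))}].
Proof. by case: he. Qed.
Variable delta : 'End(V).
Hypothesis hdelta : is_delta e delta.
Implicit Types (X Y : 'End(V)).

Local Notation L i := (2 * p i)%N.

Lemma functional_ext (F G : {scalar V}) :
  (forall i x (k : 'I_(r i)), (x < L i)%N -> F (row_vec e x k) = G (row_vec e x k)) ->
  F =1 G.
Proof.
move=> FG v; rewrite (row_coord_sum hb v) !linear_sum.
apply: eq_bigr => i _; rewrite !linear_sum; apply: eq_bigr => x _.
by rewrite !linear_sum; apply: eq_bigr => k _; rewrite !linearZ /= FG.
Qed.

Lemma delta_row_vec i x (k : 'I_(r i)) : delta (row_vec e x k) = row_vec e x.+1 k.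
Proof.
have [ltx|lex] := ltnP x (L i); last first.
  by rewrite !row_vec_out ?linear0 // (leq_trans lex).
rewrite -[x]/(val (Ordinal ltx)) row_vecE linearZ /= hdelta /ord_next /=.
case: insubP => [y _ /= Dy|]; last by rewrite -leqNgt => le; rewrite row_vec_out // scaler0.
rewrite -Dy row_vecE scalerA; congr (_ *: _).
rewrite Dy /flip_sign /eps /in_Delta /brow /pos /=.
case: leqP => [lepx|ltxp]; first by rewrite -exprSr subSn.
(* On the left half both truncated exponents are 0: [m <= n] is by definition [m - n == 0], which
   [eqP] turns into an equation. *)
by rewrite (eqP (ltnW ltxp)) (eqP ltxp) mulr1.
Qed.

Lemma row_coord_delta i x (k : 'I_(r i)) v : (x < L i)%N ->
  row_coord e x k (delta v) = if x is x'.+1 then row_coord e x' k v else 0.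
Proof.
move=> ltx; have cv j y (l : 'I_(r j)) : (y < L j)%N ->
    row_coord e x k (delta (row_vec e y l)) = [&& i == j, x == y.+1 & k == l :> nat]%:R.
  move=> lty; rewrite delta_row_vec; have [lty1|ley] := ltnP y.+1 (L j).
    by rewrite row_coord_vec.
  rewrite row_vec_out // linear0; case: (i =P j) => // ij; subst j.
  by case: eqP => // xy; subst x; rewrite ltnNge ley in ltx.
case: x ltx cv => [|x] ltx cv.
  pose F : {scalar V} := row_coord e 0 k \o delta.
  apply: (@functional_ext F \0) => j y l lty /=.
  by rewrite cv // andbF.
pose F : {scalar V} := row_coord e x.+1 k \o delta.
apply: (@functional_ext F (row_coord e x k)) => j y l lty /=.
by rewrite cv // row_coord_vec.
Qed.

Lemma entry_lie X i j (k : 'I_(r i)) (l : 'I_(r j)) x y : (x < L i)%N -> (y < L j)%N ->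
  entry e (lie delta X) k l x y = shift_br (L j) (entry e X k l) x y.
Proof.
move=> ltx lty; rewrite /entry /lie add_lfunE opp_lfunE !comp_lfunE linearB /=.
rewrite row_coord_delta // delta_row_vec /shift_br; congr (_ - _).
by case: ltnP => // le; rewrite row_vec_out ?linear0.
Qed.

Lemma sigma_vec_rev i (x : 'I_(L i)) (k l : 'I_(r i)) :
  sigma (e (a := mkbox x) k) (e (a := mkbox (rev_ord x)) l) =
    eps R (mkbox x) * (k == l)%:R.
Proof.
case: he => _ _ sig1; rewrite /eps /in_Delta /brow /pos /=; case: leqP => [lepx|ltxp].
  by rewrite hermC (sig1 (mkbox x)) //= expr1 eq_sym.
have E (y : 'I_(L i)) : y = x -> e (a := mkbox x) k = e (a := mkbox y) k by move=> ->.
rewrite mul1r (E _ (rev_ordK x)).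
rewrite (sig1 (mkbox (rev_ord x))) // /in_Delta /brow /pos /=. lia.
Qed.

(** In the rescaled basis the sign of the pairing alternates along a row, as it must for the
    unsigned shift to be skew with respect to [sigma]. *)
Lemma sigma_row_vec i j x y (k : 'I_(r i)) (l : 'I_(r j)) :
  (x < L i)%N -> (y < L j)%N ->
  sigma (row_vec e x k) (row_vec e y l) =
    [&& i == j, (x + y.+1)%N == L i & k == l :> nat]%:R * (-1) ^+ (p i + x.+1).
Proof.
case: he => _ sig0 _ ltx lty.
pose x' := Ordinal ltx; pose y' := Ordinal lty.
have -> : row_vec e x k = _ := row_vecE e (x := x') k.
have -> : row_vec e y l = _ := row_vecE e (x := y') l.
rewrite linearZl_LR linearZr_LR /=.
case: (i =P j) => [ij|nij] /=; last first.
  rewrite sig0 ?mulr0 ?mul0r //.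
  by apply/negP => /eqP/(congr1 (@brow _ _))/esym.
subst j; case: eqP => [xy|nxy] /=; last first.
  rewrite sig0 ?mulr0 ?mul0r //.
  apply/negP => /eqP/(congr1 (@pos _ _)); rewrite /pos /= => yx.
  by apply: nxy; rewrite yx; lia.
have -> : y' = rev_ord x' by apply: val_inj => /=; lia.
rewrite sigma_vec_rev val_eqE !mulrA [RHS]mulrC; congr (_ * _).
rewrite /flip_sign /eps /in_Delta /brow /pos /=.
have lt0p : (x < 2 * p i)%N := ltx.
have [lepx|ltxp] := leqP (p i) x.
  rewrite (_ : (y - p i)%N = 0%N) ?expr0 ?mulr1; last lia.
  by rewrite -exprSr; apply: eq_sign; lia.
rewrite (_ : (x - p i)%N = 0%N) ?expr0 ?mul1r; last by lia.
by rewrite mulr1; apply: eq_sign; lia.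
Qed.

(** Coordinates are pairings with mirror vectors; through this, skewness for [sigma] becomes a
    relation between entries. *)
Lemma row_coord_sigma i x (k : 'I_(r i)) v : (x < L i)%N ->
  row_coord e x k v = (-1) ^+ (p i + x.+1) * sigma v (row_vec e (L i - x.+1) k).
Proof.
move=> ltx; rewrite {2}(row_coord_sum hb v) linear_sumlz mulr_sumr.
rewrite {1}(row_coord_sum hb v) !linear_sum; apply: eq_bigr => j _.
rewrite linear_sumlz mulr_sumr !linear_sum; apply: eq_bigr => y _.
rewrite linear_sumlz mulr_sumr !linear_sum; apply: eq_bigr => l _.
rewrite linearZl_LR linearZ /= mulrCA; congr (_ * _).
rewrite row_coord_vec // sigma_row_vec //; last by lia.
case: (i =P j) => [ij|nij]; last by rewrite [j == i]eq_sym (introF eqP nij) /= mul0r mulr0.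
subst j; rewrite eqxx /= [l == k :> nat]eq_sym.
rewrite (_ : (_ == L i) = (x == y)); last by have := ltn_ord y; lia.
case: eqP => [->|_] /=; last by rewrite mul0r mulr0.
by rewrite mulrCA -expr2 sqrr_sign mulr1.
Qed.

(** The sign [- eps c * eps a] of the block relation of [sp], as it reads after the rescaling of the
    basis. *)
Definition mirror_sign i j x y : R := (-1) ^+ (p i + p j + x + y).+1.

Lemma sp_entry X i j (k : 'I_(r i)) (l : 'I_(r j)) x y :
  sp sigma X -> (x < L i)%N -> (y < L j)%N ->
  entry e X k l x y =
    mirror_sign i j x y * entry e X l k (L j - y.+1) (L i - x.+1).
Proof.
move=> spX ltx lty; rewrite /entry row_coord_sigma // row_coord_sigma; last by lia.
rewrite [sigma _ (row_vec _ (_ - (_ - _).+1) _)]hermC /= expr1.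
have -> : (L j - (L j - y.+1).+1 = y)%N by lia.
have := spX (row_vec e y l) (row_vec e (L i - x.+1) k) => /eqP.
rewrite addr_eq0 => /eqP ->; rewrite /mirror_sign !mulN1r !mulrN !mulrA; congr (- (_ * _)).
by rewrite -exprD; apply: eq_sign; lia.
Qed.

Lemma entry_sp X :
  (forall i j (k : 'I_(r i)) (l : 'I_(r j)) x y, (x < L i)%N -> (y < L j)%N ->
     entry e X k l x y =
       mirror_sign i j x y * entry e X l k (L j - y.+1) (L i - x.+1)) ->
  sp sigma X.
Proof.
move=> mX; have XE i x (k : 'I_(r i)) j y (l : 'I_(r j)) : (x < L i)%N -> (y < L j)%N ->
    sigma (X (row_vec e x k)) (row_vec e y l) + sigma (row_vec e x k) (X (row_vec e y l)) = 0.
  move=> ltx lty; apply/eqP; rewrite addr_eq0; apply/eqP.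
  (* The coordinate at position [L j - y.+1] is the pairing with [row_vec y l], up to sign. *)
  have := mX j i l k (L j - y.+1)%N x; rewrite /entry !row_coord_sigma; try lia.
  have -> : (L j - (L j - y.+1).+1 = y)%N by lia.
  have -> : (L i - (L i - x.+1).+1 = x)%N by lia.
  rewrite [sigma _ (row_vec _ x _)]hermC /= expr1.
  move=> /(_ ltac:(lia) ltac:(lia))/(congr1 ( *%R ((-1) ^+ (p j + (L j - y.+1).+1)))).
  rewrite signrMK => ->; rewrite /mirror_sign !mulN1r !mulrN !mulrA.
  by rewrite -!exprD (@eq_sign _ _ 0) ?expr0 ?mul1r //; lia.
move=> u v; have Xv i x (k : 'I_(r i)) : (x < L i)%N ->
    sigma (X u) (row_vec e x k) + sigma u (X (row_vec e x k)) = 0.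
  move=> ltx; pose w := row_vec e x k.
  pose F : {scalar V} := (applyr sigma w \o X) \+ applyr sigma (X w).
  by apply: (@functional_ext F \0) => j y l lty /=; apply: XE.
pose F : {scalar V} := sigma (X u) \+ (sigma u \o X).
by apply: (@functional_ext F \0) => i x k ltx /=; apply: Xv.
Qed.

End Dictionary.

(** * Degrees and blocks in terms of entries *)

Section Grading.
Variables (R : realType) (s : nat) (p r : 'I_s -> nat) (V : vectType R).
Variables (sigma : {skew_symmetric V}).
Variable e : forall a : box p, 'I_(r (brow a)) -> V.
Hypothesis he : darboux_basis sigma e.
Let hb : basis_of {:V} [seq e (tagged z) | z : {a : box p & 'I_(r (brow a))}].
Proof. by case: he. Qed.
Implicit Types (X Y : 'End(V)).

Local Notation L i := (2 * p i)%N.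

(** One affine formula serves both halves of a row, so that degrees can be compared by linear
    arithmetic. *)
Lemma deg_mkbox i (x : 'I_(L i)) : deg (mkbox x) = (p i)%:Z - 1 - x%:Z.
Proof.
rewrite /deg /in_Delta /column /mirror /brow /pos /=; have := ltn_ord x.
by case: (leqP (p i) x) => *; lia.
Qed.

Lemma row_vec_Espan i (x : 'I_(L i)) (k : 'I_(r i)) : row_vec e x k \in Espan e (mkbox x).
Proof. by rewrite row_vecE memvZ // memv_span // (map_f (e (a := mkbox x))) // mem_enum. Qed.

Lemma row_coord_Espan i (x : 'I_(L i)) (k : 'I_(r i)) a v :
  v \in Espan e a -> a != mkbox x -> row_coord e x k v = 0.
Proof.
case: a => j y; rewrite -[existT _ j y]/(mkbox y) => vE neq.
have {}vE : v \in <<in_tuple [seq e (a := mkbox y) l | l : 'I_(r j)]>>%VS by [].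
rewrite (coord_span vE) linear_sum big1 // => t _.
rewrite linearZ /=; have : (in_tuple [seq e (a := mkbox y) l | l : 'I_(r j)])`_t
  \in [seq e (a := mkbox y) l | l : 'I_(r j)] by apply: mem_nth.
move=> /mapP[l _ ->]; rewrite vec_rowE linearZ /= row_coord_vec //.
case: (i =P j) => [ij|] /=; last by rewrite !mulr0.
subst j; case: eqP => [xy|] /=; last by rewrite !mulr0.
by case/eqP: neq; congr (mkbox _); apply: val_inj.
Qed.

Lemma mem_sum_Espan (P : pred (box p)) v :
  v \in (\sum_(a | P a) Espan e a)%VS <->
  forall i (x : 'I_(L i)) (k : 'I_(r i)), ~~ P (mkbox x) -> row_coord e x k v = 0.
Proof.
split=> [/memv_sumP[w wE ->] i x k nPx|v0].
  rewrite linear_sum big1 // => a Pa; apply: row_coord_Espan (wE a Pa) _.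
  by apply: contraNneq nPx => <-.
rewrite (row_coord_sum hb v); apply: memv_suml => i _; apply: memv_suml => x _.
apply: memv_suml => k _; have [Px|nPx] := boolP (P (mkbox x)).
  by rewrite memvZ // (subvP (sumv_sup _ Px (subvv _))) // row_vec_Espan.
by rewrite v0 // scale0r mem0v.
Qed.

(** Stated for arbitrary predicates on boxes, so as to cover both the grading [Vdeg] and the
    filtration [Vge]. *)
Lemma img_sum_Espan (P Q : pred (box p)) X :
  (X @: (\sum_(a | P a) Espan e a) <= \sum_(a | Q a) Espan e a)%VS <->
  forall i (x : 'I_(L i)) (k : 'I_(r i)) j (y : 'I_(L j)) (l : 'I_(r j)), P (mkbox y) -> ~~ Q (mkbox x) ->
    entry e X k l x y = 0.
Proof.
split=> [/subvP XPQ i x k j y l Py nQx|X0].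
  suff yP : row_vec e y l \in (\sum_(a | P a) Espan e a)%VS.
    by have [+ _] := mem_sum_Espan Q (X (row_vec e y l)); apply => //; apply/XPQ/memv_img.
  apply/mem_sum_Espan => i' x' k' nPx'; rewrite row_coord_vec //.
  case: (i' =P j) => //= ij; subst i'; case: eqP => //= xy.
  by rewrite (_ : x' = y) ?Py // in nPx'; apply: val_inj.
apply/subvP => _ /memv_imgP[v /mem_sum_Espan vP ->].
apply/mem_sum_Espan => i x k nQx; rewrite entry_app // big1 // => j _.
rewrite big1 // => y _; rewrite big1 // => l _.
by have [Py|nPy] := boolP (P (mkbox y)); [rewrite X0 // mulr0|rewrite vP // mul0r].
Qed.

(** The entry at (x, y) maps degree [p j - 1 - y] to degree [p i - 1 - x]; the equation says that
    the difference is [k], without subtractions. *)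
Lemma g_entry (k : int) X : g_ sigma e k X <->
  sp sigma X /\ forall i j (t : 'I_(r i)) (u : 'I_(r j)) x y,
    (x < L i)%N -> (y < L j)%N -> entry e X t u x y != 0 ->
    (p i + y)%:Z = (p j + x)%:Z + k.
Proof.
split=> -[spX Xk]; split=> //.
  move=> i j t u x y ltx lty; apply: contraNeq => neq.
  have [+ _] := img_sum_Espan (fun a => deg a == deg (mkbox (Ordinal lty)))
    (fun a => deg a == deg (mkbox (Ordinal lty)) + k) X.
  move=> /(_ (Xk _) i (Ordinal ltx) t j (Ordinal lty) u) -> //.
  by rewrite !deg_mkbox /=; apply: contra neq => /eqP; lia.
move=> d; apply/img_sum_Espan => i x t j y u /eqP dy nx; apply: contraNeq nx => nz.
by have := Xk _ _ _ _ _ _ (ltn_ord x) (ltn_ord y) nz; rewrite deg_mkbox in dy; rewrite deg_mkbox; lia.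
Qed.

Lemma entry_Vge X : (forall j, (X @: Vge e j <= Vge e j)%VS) ->
  forall i j (t : 'I_(r i)) (u : 'I_(r j)) x y,
    (x < L i)%N -> (y < L j)%N -> entry e X t u x y != 0 -> (p j + x <= p i + y)%N.
Proof.
move=> XV i j t u x y ltx lty; apply: contraNT => nle.
have [+ _] := img_sum_Espan (fun a => (deg (mkbox (Ordinal lty)) <= deg a)%R)
  (fun a => (deg (mkbox (Ordinal lty)) <= deg a)%R) X.
move=> /(_ (XV _) i (Ordinal ltx) t j (Ordinal lty) u) -> //.
by rewrite !deg_mkbox /=; lia.
Qed.

Lemma row_coord_blocks (w : forall c : box p, 'I_(r (brow c)) -> R)
    i (x : 'I_(L i)) (k : 'I_(r i)) :
  row_coord e x k (\sum_c \sum_(t < r (brow c)) w c t *: e (a := c) t) =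
    flip_sign R p i x * w (mkbox x) k.
Proof.
rewrite (bigD1 (mkbox x)) //= linearD /= addrC linear_sum big1 ?add0r => [|c neq].
  rewrite (bigD1 k) //= linearD /= linearZ /= vec_rowE linearZ /= row_coord_vec //.
  rewrite !eqxx mulr1 mulrC linear_sum big1 ?addr0 // => t neq.
  rewrite linearZ /= vec_rowE linearZ /= row_coord_vec // !eqxx /=.
  by rewrite val_eqE eq_sym (negPf neq) !mulr0.
apply: row_coord_Espan neq; apply: memv_suml => t _; rewrite memvZ // memv_span //.
by rewrite (map_f (e (a := c))) // mem_enum.
Qed.

Lemma blocks_entry X M i j (x : 'I_(L i)) (y : 'I_(L j)) (k : 'I_(r i)) (l : 'I_(r j)) :
  blocks_of e X M ->
  M (mkbox x) (mkbox y) k l = flip_sign R p i x * flip_sign R p j y * entry e X k l x y.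
Proof.
move=> XM; rewrite /entry row_vecE linearZ /= linearZ /= XM.
rewrite (row_coord_blocks (fun c t => M c (mkbox y) t l)) -mulrA.
by rewrite [flip_sign R p j y * (_ * _)]mulrA flip_signK mul1r mulrA flip_signK mul1r.
Qed.

Lemma entry_blocks X : blocks_of e X
  (fun c a => \matrix_(k, l) (flip_sign R p (brow c) (pos c) *
     flip_sign R p (brow a) (pos a) * entry e X k l (pos c) (pos a))).
Proof.
move=> [j y] l; rewrite -[existT _ j y]/(mkbox y); apply: (row_coord_ext hb) => i x k ltx.
rewrite -[x]/(val (Ordinal ltx)) row_coord_blocks mxE vec_rowE linearZ /= linearZ /=.
by rewrite -/(entry _ _ _ _ _ _) !mulrA flip_signK mul1r.
Qed.

End Grading.

(** * The centralizer of [delta] and the spaces [u_ k] *)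

Section Normalization.
Variables (R : realType) (s : nat) (p r : 'I_s -> nat) (V : vectType R).
Hypothesis hp : forall i j : 'I_s, (i < j)%N -> (p j < p i)%N.
Variables (sigma : {skew_symmetric V}).
Variable e : forall a : box p, 'I_(r (brow a)) -> V.
Hypothesis he : darboux_basis sigma e.
Let hb : basis_of {:V} [seq e (tagged z) | z : {a : box p & 'I_(r (brow a))}].
Proof. by case: he. Qed.
Variable delta : 'End(V).
Hypothesis hdelta : is_delta e delta.
Implicit Types (X Y : 'End(V)).

Local Notation L i := (2 * p i)%N.

Lemma p_inj : injective p.
Proof.
move=> i j pij; apply: ord_inj; case: (ltngtP i j) => // /hp; by rewrite pij ltnn.
Qed.

Lemma lt_row_p (i j : 'I_s) : (j <= i)%N -> (p i <= p j)%N.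
Proof. by rewrite leq_eqVlt => /orP[/eqP/ord_inj ->|/hp/ltnW]. Qed.

Lemma p_le_sum i : (p i <= \sum_j p j)%N.
Proof. by rewrite (bigD1 i) //= leq_addr. Qed.

Definition nonneg_degree X := forall i j (k : 'I_(r i)) (l : 'I_(r j)) x y,
  (x < L i)%N -> (y < L j)%N -> entry e X k l x y != 0 -> (p j + x <= p i + y)%N.

(** Keeps track of degrees: the last equation says that the bracket with [delta] lowers the degree
    by one. *)
Lemma entry_lie_neq0 X i j (k : 'I_(r i)) (l : 'I_(r j)) x y :
  (x < L i)%N -> (y < L j)%N -> entry e (lie delta X) k l x y != 0 ->
  exists x' y', [/\ (x' < L i)%N, (y' < L j)%N, entry e X k l x' y' != 0 &
    (x + y' = x' + y + 1)%N].
Proof.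
move=> ltx lty; rewrite (entry_lie he hdelta) // /shift_br.
case: x ltx => [|x] ltx; case: ltnP => lty1; rewrite ?sub0r ?subr0 ?oppr0 ?oppr_eq0 ?eqxx // => nz.
- by exists 0%N, y.+1; split => //; lia.
- have [x0|x0] := eqVneq (entry e X k l x y) 0; last by exists x, y; split=> //; lia.
  by rewrite x0 sub0r oppr_eq0 in nz; exists x.+1, y.+1; split => //; lia.
- by exists x, y; split=> //; lia.
Qed.

Lemma lieN X : lie X delta = - lie delta X.
Proof. by rewrite /lie opprB. Qed.

Lemma entry_lieN X i j (k : 'I_(r i)) (l : 'I_(r j)) x y :
  entry e (lie X delta) k l x y = - entry e (lie delta X) k l x y.
Proof. by rewrite lieN entryN. Qed.

(** A diagonal that leaves through the top or the right carries zeros, so [y <= x] and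
    [L i - L j <= x - y]. Nonnegative degree adds [x - y <= p i - p j]. Together these force
    [p i = p j], hence [i = j], and [x = y]. *)
Lemma entry_centralizer X i j (k : 'I_(r i)) (l : 'I_(r j)) x y :
  nonneg_degree X -> lie delta X = 0 -> (x < L i)%N -> (y < L j)%N ->
  entry e X k l x y != 0 -> i = j /\ x = y.
Proof.
move=> X0 dX ltx lty nz; have le0 := X0 _ _ _ _ _ _ ltx lty nz.
have a0 x' y' : (x' < L i)%N -> (y' < L j)%N ->
    shift_br (L j) (entry e X k l) x' y' = 0.
  by move=> *; rewrite -(entry_lie he hdelta) // dX entry0.
have leyx : (y <= x)%N.
  by rewrite leqNgt; apply: contraNN nz => ltxy; rewrite (shift_br0_down a0).
have leL : (L i <= x + (L j - y))%N.
  by rewrite leqNgt; apply: contraNN nz => ltL; rewrite (shift_br0_up a0).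
have pij : p i = p j by lia.
by split; [apply: p_inj|lia].
Qed.

Lemma entry_centralizer_diag X i (k l : 'I_(r i)) x : lie delta X = 0 ->
  (x < L i)%N -> entry e X k l x x = entry e X k l 0%N 0%N.
Proof.
move=> dX; elim: x => // x IHx ltx; rewrite -IHx ?(ltnW ltx) //.
apply/esym/eqP; rewrite -subr_eq0; apply/eqP.
have := entry_lie he hdelta X k l ltx (ltnW ltx).
by rewrite dX entry0 /shift_br ltx => /esym.
Qed.

(* A nonnegative X commuting with delta is constant along the diagonals, whereas the
   diagonal sums of a bracket with delta vanish. *)
Lemma centralizer_bracket X Y :
  nonneg_degree X -> lie delta X = 0 -> X = lie delta Y -> X = 0.
Proof.
move=> X0 dX XY; apply: (entry_ext hb) => i j k l x y ltx lty; rewrite entry0.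
have [//|nz] := eqVneq (entry e X k l x y) 0.
have [ij xy] := entry_centralizer X0 dX ltx lty nz; subst j y.
rewrite entry_centralizer_diag //.
have := sum_diag_shift_br (L i) (entry e Y k l).
under eq_bigr => t _ do rewrite -(entry_lie he hdelta) // -XY entry_centralizer_diag //.
(* A sum of [L i] equal terms is 0, and [L i] is positive because [x < L i]. *)
rewrite sumr_const card_ord => /eqP; rewrite mulrn_eq0 => /orP[|/eqP //].
by move/eqP; lia.
Qed.

Lemma ad_stable_centralizer (B : set 'End(V)) :
  (forall X, B X -> nonneg_degree X) -> (forall X, B X -> B (lie X delta)) ->
  forall X, B X -> lie delta X = 0.
Proof.
move=> B0 BL; have step N X : B X ->
    (forall i j (k : 'I_(r i)) (l : 'I_(r j)) x y, (x < L i)%N -> (y < L j)%N ->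
      entry e X k l x y != 0 -> (p i + y <= p j + x + N)%N) -> lie delta X = 0.
  (* [N] bounds the degrees of the nonzero entries. For [N = 0] the bracket could only have negative
     degrees, which [B] excludes. *)
  elim: N X => [|N IHN] X BX XN.
    apply: (entry_ext hb) => i j k l x y ltx lty; rewrite entry0.
    have [//|nz] := eqVneq (entry e (lie delta X) k l x y) 0.
    have [x' [y' [ltx' lty' nz' xy]]] := entry_lie_neq0 ltx lty nz.
    have := XN _ _ _ _ _ _ ltx' lty' nz'.
    have nzN : entry e (lie X delta) k l x y != 0 by rewrite entry_lieN oppr_eq0.
    by have := B0 _ (BL _ BX) _ _ _ _ _ _ ltx lty nzN; lia.
  have dX : lie delta (lie X delta) = 0.
    apply: IHN (BL _ BX) _ => i j k l x y ltx lty; rewrite entry_lieN oppr_eq0 => nz.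
    have [x' [y' [ltx' lty' nz' xy]]] := entry_lie_neq0 ltx lty nz.
    by have := XN _ _ _ _ _ _ ltx' lty' nz'; lia.
  apply/eqP; rewrite -oppr_eq0 -lieN; apply/eqP.
  apply: (centralizer_bracket (B0 _ (BL _ BX)) dX (Y := - X)).
  by rewrite /lie comp_lfunNl comp_lfunNr opprK addrC.
(* The degree of an entry is less than [p i + p j], whatever X is. *)
move=> X BX; apply: (step (\sum_i p i + \sum_i p i)%N) => // i j k l x y ltx lty _.
by have := p_le_sum i; have := p_le_sum j; lia.
Qed.

Lemma g_nonneg (k : nat) X : g_ sigma e k%:Z X -> nonneg_degree X.
Proof.
by case/(g_entry he) => _ Xk i j t u x y ltx lty nz; have := Xk _ _ _ _ _ _ ltx lty nz; lia.
Qed.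

Lemma u_g k X : u_ sigma e delta k X -> g_ sigma e k%:Z X.
Proof. by case: k => [|k] []. Qed.

(** The union of all the [u_ m] is stable under the bracket with [delta], since [u_ 0] is sent to
    0. *)
Lemma u_centralizer k X : u_ sigma e delta k X -> lie delta X = 0.
Proof.
move=> uX; pose B := [set Y | exists k, u_ sigma e delta k Y]%classic.
apply: (ad_stable_centralizer (B := B)); last by exists k.
  by move=> Y [m /u_g/g_nonneg].
move=> Y [[|m] [gY uY]]; last by exists m.
rewrite uY; exists 0%N; split; last by rewrite /lie !comp_lfun0l !comp_lfun0r subrr.
split=> [u v|d]; first by rewrite !zero_lfunE linear0l linear0r addr0.
by rewrite lim0g // sub0v.
Qed.

(** A nonnegative X commuting with [delta] lives on the main diagonals of the diagonal blocks, and
    these have degree 0. *)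
Lemma u_pos k X : u_ sigma e delta k.+1 X -> X = 0.
Proof.
move=> uX; have dX := u_centralizer uX; have gX := u_g uX.
apply: (entry_ext hb) => i j t u x y ltx lty; rewrite entry0.
have [//|nz] := eqVneq (entry e X t u x y) 0.
have [ij xy] := entry_centralizer (g_nonneg gX) dX ltx lty nz; subst j y.
by case/(g_entry he): gX => _ /(_ _ _ _ _ _ _ ltx lty nz); lia.
Qed.

Lemma sp0 : sp sigma (0 : 'End(V)).
Proof. by move=> u v; rewrite !zero_lfunE linear0l linear0r addr0. Qed.

Lemma sp_comb c X Y : sp sigma X -> sp sigma Y -> sp sigma (c *: X + Y).
Proof.
move=> spX spY u v; rewrite !add_lfunE !scale_lfunE linearDl linearDr linearZl_LR linearZr_LR /=.
by rewrite addrACA -mulrDr spX spY mulr0 addr0.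
Qed.

Lemma sp_sum n (f : nat -> 'End(V)) : (forall k, sp sigma (f k)) -> sp sigma (\sum_(k < n) f k).
Proof.
move=> spf; elim/big_rec: _ => [|k X _ spX]; first exact: sp0.
by rewrite -[f k]scale1r; apply: sp_comb.
Qed.

Lemma nonneg_degree_sum n (f : nat -> 'End(V)) :
  (forall k, nonneg_degree (f k)) -> nonneg_degree (\sum_(k < n) f k).
Proof.
move=> f0 i j t u x y ltx lty; rewrite entry_sum; apply: contraNT => lt.
rewrite big1 // => k _; apply/eqP; apply: contraNT lt => nz.
exact: f0 nz.
Qed.

(** The mirror relation pairs entries of equal degree, so cutting the matrix of X by degree does not
    leave [sp]. *)
Lemma homogeneous_components X : sp sigma X -> nonneg_degree X ->
  exists f : nat -> 'End(V), [/\ forall k, g_ sigma e k%:Z (f k),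
    forall k i j (t : 'I_(r i)) (u : 'I_(r j)) x y, (x < L i)%N -> (y < L j)%N ->
      entry e (f k) t u x y = if (p i + y == p j + x + k)%N then entry e X t u x y else 0
    & exists n, X = \sum_(k < n) f k].
Proof.
move=> spX X0.
have [f Df] := choice (fun k => entry_hom hb (fun i j t u x y =>
  if (p i + y == p j + x + k)%N then entry e X t u x y else 0)).
exists f; split=> // [k|].
  apply/(g_entry he); split.
    apply: (entry_sp he) => i j t u x y ltx lty; rewrite !Df //; try lia.
    rewrite (sp_entry he t u spX) //.
    rewrite (_ : (p j + (L i - x.+1) == _)%N = (p i + y == p j + x + k)%N); last by lia.
    by case: eqP; rewrite ?mulr0.
  move=> i j t u x y ltx lty; rewrite Df //; case: (_ =P (_ + k)%N) => [? _|_]; last by rewrite eqxx.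
  by lia.
exists (\sum_i p i + \sum_i p i)%N; apply: (entry_ext hb) => i j t u x y ltx lty.
rewrite entry_sum (eq_bigr _ (fun k _ => Df _ _ _ _ _ _ _ ltx lty)).
have [X00|nz] := eqVneq (entry e X t u x y) 0.
  by rewrite X00 big1 // => k _; case: ifP.
have le := X0 _ _ _ _ _ _ ltx lty nz.
have ltk : (p i + y - (p j + x) < \sum_i p i + \sum_i p i)%N.
  by have := p_le_sum i; have := p_le_sum j; lia.
rewrite (bigD1 (Ordinal ltk)) //= subnKC // eqxx big1 ?addr0 // => k neq.
by case: eqP => // Dk; case/eqP: neq; apply: val_inj => /=; lia.
Qed.

Lemma gnonneg_entry X : gnonneg sigma e X <-> sp sigma X /\ nonneg_degree X.
Proof.
split=> [[n [f [gf ->]]]|[spX X0]]; last first.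
  by have [f [gf _ [n Xf]]] := homogeneous_components spX X0; exists n, f.
split; first by apply: sp_sum => k; case: (gf k).
by apply: nonneg_degree_sum => k; apply: g_nonneg (gf k).
Qed.

End Normalization.

(** * The choice [phi] in terms of positions and diagonals *)

Section Assignment.
Variables (s : nat) (p : 'I_s -> nat).
Variable phi : box p -> box p -> box p * box p.
Hypothesis hphi : is_assignment phi.

Local Notation L i := (2 * p i)%N.

Lemma mkbox_inj i (x y : 'I_(L i)) : mkbox x = mkbox y -> x = y.
Proof. by move=> /(congr1 (@pos _ _))/ord_inj. Qed.

Lemma lpow_mkbox t i (x : 'I_(L i)) c : lpow t (mkbox x) = Some c ->
  exists2 y : 'I_(L i), c = mkbox y & (y + t)%N = x.
Proof.
elim: t c => [|t IHt] c; first by case=> <-; exists x; rewrite ?addn0.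
rewrite /lpow /= -/(lpow t _); case: (lpow t _) IHt => // b /(_ b erefl)[y -> yt] /=.
rewrite /lbox /= /ord_prev; case Dy: (val y) => [|z] //.
case: insubP => [w _ /= Dw|] //= [<-]; exists w => //.
by rewrite Dw; have : y = z.+1 :> nat by []; lia.
Qed.

Lemma is_last_mkbox j (y : 'I_(L j)) : is_last (mkbox y) = (y.+1 == L j).
Proof.
rewrite /is_last /rbox /= /ord_next; case: insubP => [w /= lt _|nlt] /=.
  by apply/esym/negbTE; rewrite neq_ltn lt.
by rewrite eqxx; apply/esym/eqP; have := ltn_ord y; lia.
Qed.

(** The rows of [b] and [rho] are left open; that they are [i] and [j] follows from [phi] being an
    assignment. *)
Definition selected i j x y : Prop := exists (x' : 'I_(L i)) (y' : 'I_(L j)) b rho,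
  [/\ x' = x :> nat, y' = y :> nat, admissible b rho & phi b rho = (mkbox x', mkbox y')].

Definition in_support i j x y : Prop :=
  selected i j x y \/ selected j i (L j - y.+1) (L i - x.+1).

Lemma assignmentP i j (b x : 'I_(L i)) (rho y : 'I_(L j)) :
  admissible (mkbox b) (mkbox rho) ->
  phi (mkbox b) (mkbox rho) = (mkbox x, mkbox y) ->
  exists t, [/\ rho.+1 = L j, (x + t)%N = b, (y + t)%N = rho & (j <= i)%N].
Proof.
move=> adm phiE; have [t [/lpow_mkbox[x1 + x1t] /lpow_mkbox[y1 + y1t]]] := hphi adm.
rewrite phiE /= => /mkbox_inj Dx /mkbox_inj Dy; exists t; rewrite Dx Dy.
by case/and3P: adm; rewrite is_last_mkbox => /eqP.
Qed.

Lemma selectedP i j x y : selected i j x y ->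
  exists (b x' : 'I_(L i)) (rho y' : 'I_(L j)),
    [/\ x' = x :> nat, y' = y :> nat, admissible (mkbox b) (mkbox rho)
      & phi (mkbox b) (mkbox rho) = (mkbox x', mkbox y')].
Proof.
move=> [x' [y' [[i' b] [[j' rho] [<- <- adm phiE]]]]].
rewrite -[existT _ i' b]/(mkbox b) -[existT _ j' rho]/(mkbox rho) in adm phiE.
have [t [/lpow_mkbox[x1 Dx1 x1t] /lpow_mkbox[y1 Dy1 y1t]]] := hphi adm.
rewrite phiE /= in Dx1 Dy1.
have ii' : i = i' by have := congr1 (@brow _ _) Dx1.
have jj' : j = j' by have := congr1 (@brow _ _) Dy1.
by subst i' j'; exists b, x', rho, y'.
Qed.

(** Moving (x, y) along its diagonal leads to (b, rho) with [rho] the last position. The bounds say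
    that [b] lies in its row, and to the left of [rho] when the rows agree. *)
Lemma selected_degree i j x y : selected i j x y ->
  [/\ (j <= i)%N, (x + L j < L i + y.+1)%N & i = j -> (x < y)%N].
Proof.
move=> /selectedP[b [x' [rho [y' [Dx Dy adm]]]]] /(assignmentP adm).
rewrite Dx Dy => -[t [last_rho xt yt ji]]; split=> [//||ij].
  by have := ltn_ord b; lia.
subst j; case/and3P: adm => _ neq _.
have : b != rho by apply: contraNneq neq => ->.
by rewrite -val_eqE /=; have := ltn_ord b; lia.
Qed.

Lemma exists_selected (i j : 'I_s) b : (j <= i)%N -> (b < L i)%N -> (0 < L j)%N ->
  (i = j -> b.+1 != L j) ->
  exists x y t, [/\ (x + t)%N = b, (y + t).+1 = L j & selected i j x y].
Proof.
move=> ji ltb Lj nlast; pose b' := Ordinal ltb.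
have ltr : ((L j).-1 < L j)%N by lia.
have adm : admissible (mkbox b') (mkbox (Ordinal ltr)).
  rewrite /admissible is_last_mkbox /not_higher /= prednK // eqxx ji andbT.
  apply/negP => /eqP br; have ij := congr1 (@brow _ _) br; rewrite /brow /= in ij.
  by have := congr1 (@pos _ _) br; rewrite /pos /= => Db; have := nlast ij; lia.
have [t [/lpow_mkbox[x Dx xt] /lpow_mkbox[y Dy yt]]] := hphi adm.
exists x, y, t; split=> //; first by rewrite yt /= prednK.
exists x, y, (mkbox b'), (mkbox (Ordinal ltr)); split=> //.
by rewrite -Dx -Dy; case: (phi _ _).
Qed.

(** A diagonal meets the last column at most once, so both pairs are the value of [phi] at the same
    (b, rho). *)
Lemma selected_uniq i j x y x' y' : selected i j x y -> selected i j x' y' ->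
  (x + y' = x' + y)%N -> x = x'.
Proof.
move=> /selectedP[b [x1 [rho [y1 [Dx Dy adm Dphi]]]]].
move=> /selectedP[b' [x1' [rho' [y1' [Dx' Dy' adm' Dphi']]]]] xy.
have [t [lr xt yt _]] := assignmentP adm Dphi.
have [t' [lr' xt' yt' _]] := assignmentP adm' Dphi'.
have bb : b = b' by apply: ord_inj; lia.
have rr : rho = rho' by apply: ord_inj; lia.
by move: Dphi'; rewrite -bb -rr Dphi => -[]; rewrite -Dx -Dx' => /mkbox_inj -> _.
Qed.

End Assignment.

(** * Membership in [N_] in terms of entries *)

Section NormalForm.
Variables (R : realType) (s : nat) (p r : 'I_s -> nat) (V : vectType R).
Variables (sigma : {skew_symmetric V}).
Variable e : forall a : box p, 'I_(r (brow a)) -> V.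
Hypothesis he : darboux_basis sigma e.
Let hb : basis_of {:V} [seq e (tagged z) | z : {a : box p & 'I_(r (brow a))}].
Proof. by case: he. Qed.
Variable phi : box p -> box p -> box p * box p.
Hypothesis hphi : is_assignment phi.
Implicit Types (X Y : 'End(V)).

Local Notation L i := (2 * p i)%N.

Lemma mirrorK : involutive (@mirror s p).
Proof. by move=> [i x]; rewrite /mirror /mkbox /= rev_ordK. Qed.

Lemma mirror_pairK : involutive (@mirror_pair s p).
Proof. by move=> [a b]; rewrite /mirror_pair /= !mirrorK. Qed.

Lemma flip_sign_rev i (x : 'I_(L i)) :
  flip_sign R p i (rev_ord x) = eps R (mkbox x) * (-1) ^+ (p i + x).+1 * flip_sign R p i x.
Proof.
rewrite /flip_sign /eps /in_Delta /brow /pos /=; case: (leqP (p i) x) => [le|lt].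
  by rewrite -exprS -exprD; apply: eq_sign; lia.
by rewrite mul1r -exprD; apply: eq_sign; lia.
Qed.

(** The two parity cases merge into the sign [(-1) ^+ (x + y).+1], and the condition on the mirror
    block follows from the one on the block itself together with [sp]. *)
Lemma N_entry X : N_ sigma e phi X <->
  [/\ sp sigma X, nonneg_degree e X,
    forall i j (k : 'I_(r i)) (l : 'I_(r j)) x y, (x < L i)%N -> (y < L j)%N ->
      entry e X k l x y != 0 -> in_support phi i j x y
  & forall i (k l : 'I_(r i)) x y, selected phi i i x y ->
      entry e X k l x y = (-1) ^+ (x + y).+1 * entry e X l k x y].
Proof.
split=> [[/(gnonneg_entry he)[spX X0]] [M XM [supM symM]]|[spX X0 supX symX]].
  split=> // [i j k l x y ltx lty nz|i k l x y].
    pose x' := Ordinal ltx; pose y' := Ordinal lty.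
    have nzM : M (mkbox x') (mkbox y') != 0.
      apply: contraNneq nz => M0; have := blocks_entry he x' y' k l XM.
      rewrite M0 mxE => /esym/eqP.
      by rewrite mulf_eq0 mulf_eq0 !signr_eq0.
    have [b [rho [adm [phiE|phiE]]]] := supM _ _ nzM.
      by left; exists x', y', b, rho.
    right; exists (rev_ord y'), (rev_ord x'), b, rho; split=> //.
    by rewrite -[phi _ _]mirror_pairK -phiE.
  move=> /(selectedP hphi)[b [x' [rho [y' [Dx Dy adm phiE]]]]].
  have [t [lr xt yt _]] := assignmentP hphi adm phiE.
  have /= := symM _ _ _ _ _ adm phiE; rewrite -{x}Dx -{y}Dy in xt yt *.
  have Mkl := blocks_entry he x' y' k l XM.
  have Mlk := blocks_entry he x' y' l k XM.
  have nz : flip_sign R p i x' * flip_sign R p i y' != 0 by rewrite mulf_neq0 ?signr_eq0.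
  (* From [x + t = b] and [y + t = L i - 1], the numbers [b.+1] and [x + y] have the same parity. *)
  case: ifP => odd_b [/matrixP/(_ l k) + _]; rewrite !mxE Mkl Mlk.
    rewrite (@eq_sign _ _ 0); last by lia.
    by move=> /(mulfI nz) ->; rewrite mul1r.
  rewrite (@eq_sign _ _ 1); last by lia.
  by rewrite -mulrN => /(mulfI nz) ->; rewrite mulN1r.
split; first exact/(gnonneg_entry he).
have XM := entry_blocks he X; set M := (M in blocks_of e X M) in XM.
exists M => //; split=> [[i x] [j y] nz|i b rho x y adm phiE c a sgn].
  rewrite -[existT _ i x]/(mkbox x) -[existT _ j y]/(mkbox y) in nz *.
  have [k [l nzkl]] : exists k l, entry e X (i := i) (j := j) k l x y != 0.
    apply/not_existsP => no; case/eqP: nz; apply/matrixP => k l; rewrite !mxE.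
    have [->|nzkl] := eqVneq (entry e X k l (pos (mkbox x)) (pos (mkbox y))) 0.
      by rewrite mulr0.
    by case: (no k); exists l.
  have [] := supX _ _ _ _ _ _ (ltn_ord x) (ltn_ord y) nzkl.
    move=> [x' [y' [b [rho [/ord_inj-> /ord_inj-> adm phiE]]]]].
    by exists b, rho; split=> //; left.
  move=> [y' [x' [b [rho [Dy Dx adm phiE]]]]]; exists b, rho; split=> //; right.
  rewrite phiE /mirror_pair /= (_ : y' = rev_ord y) 1?(_ : x' = rev_ord x); try exact: ord_inj.
  by rewrite -[mkbox x]mirrorK -[mkbox y]mirrorK.
have [t [lr xt yt _]] := assignmentP hphi adm phiE.
have sel : selected phi i i x y by exists x, y, (mkbox b), (mkbox rho).
(* The relation of [sp] gives the mirror block as a signed transpose, and the symmetry of the block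
   removes the transposition. *)
have mirE : M (mirror a) (mirror c) = (-1) ^+ (x + y).+1 * sgn *: M c a.
  apply/matrixP => k l; rewrite !mxE /brow /pos /=.
  have -> : entry e X k l (rev_ord y) (rev_ord x) = entry e X k l x y.
    have := sp_entry he l k spX (ltn_ord x) (ltn_ord y); rewrite symX // /mirror_sign.
    have -> : (-1) ^+ (p i + p i + x + y).+1 = (-1) ^+ (x + y).+1 :> R.
      by apply: eq_sign; lia.
    by move=> /(can_inj (signrMK _)).
  rewrite !flip_sign_rev /sgn.
  have -> : (-1) ^+ (x + y).+1 = - ((-1) ^+ (p i + x).+1 * (-1) ^+ (p i + y).+1) :> R.
    by rewrite -exprD -[RHS]mulN1r -exprS; apply: eq_sign; lia.
  by ring.
have MT : (M c a)^T = (-1) ^+ (x + y).+1 *: M c a.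
  by apply/matrixP => k l; rewrite !mxE /brow /pos /= mulrCA; congr (_ * _); apply: symX.
case: ifP => odd_b.
  by move: mirE MT; rewrite (@eq_sign _ _ 0) ?expr0 ?mul1r ?scale1r //; lia.
by move: mirE MT; rewrite (@eq_sign _ _ 1) ?expr1 ?mulN1r ?scaleN1r //; lia.
Qed.

End NormalForm.

(** * [N_] contains no nonzero bracket with [delta] *)

Section Uniqueness.
Variables (R : realType) (s : nat) (p r : 'I_s -> nat) (V : vectType R).
Hypothesis hp : forall i j : 'I_s, (i < j)%N -> (p j < p i)%N.
Variables (sigma : {skew_symmetric V}).
Variable e : forall a : box p, 'I_(r (brow a)) -> V.
Hypothesis he : darboux_basis sigma e.
Let hb : basis_of {:V} [seq e (tagged z) | z : {a : box p & 'I_(r (brow a))}].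
Proof. by case: he. Qed.
Variable delta : 'End(V).
Hypothesis hdelta : is_delta e delta.
Variable phi : box p -> box p -> box p * box p.
Hypothesis hphi : is_assignment phi.
Implicit Types (X Y W : 'End(V)).

Local Notation L i := (2 * p i)%N.

(** The diagonal of (x, y), followed to the last column, has sum 0 because X is a bracket. On it
    only the selected entry and, if [i = j], its mirror entry can be nonzero. These two are equal,
    so the entry or its double vanishes. *)
Lemma selected_entry_bracket X W i j (k : 'I_(r i)) (l : 'I_(r j)) x y :
  N_ sigma e phi X -> X = lie delta W -> selected phi i j x y -> entry e X k l x y = 0.
Proof.
move=> /(N_entry he hphi)[spX X0 supX symX] XW sel.
have [b [x' [rho [y' [Dx Dy adm phiE]]]]] := selectedP hphi sel.
have [t [lr xt yt ji]] := assignmentP hphi adm phiE.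
have lepp := lt_row_p hp ji; have ltb := ltn_ord b; have ltr := ltn_ord rho.
have : diag_sum (entry e X k l) b (L j).-1 = 0.
  rewrite (@eq_diag_sum _ (L i) (L j) _ (shift_br (L j) (entry e W k l))) //; last first.
  - by move=> ? ? ? ?; rewrite XW (entry_lie he hdelta).
  - by lia.
  by rewrite diag_sum_shift_br ?ifF ?oppr0 //; lia.
rewrite /diag_sum.
have lt_t : (t < (minn b (L j).-1).+1)%N by lia.
rewrite (bigD1 (Ordinal lt_t)) //=.
have -> : (b - t)%N = x by lia.
have -> : ((L j).-1 - t)%N = y by lia.
(* Another nonzero entry on the diagonal is not selected, by uniqueness, so its mirror is; this
   forces [i = j] and the index [x]. *)
have only (t' : 'I_(minn b (L j).-1).+1) : t' != Ordinal lt_t ->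
    i != j \/ t' != x :> nat -> entry e X k l (b - t') ((L j).-1 - t') = 0.
  move=> neq nij; have [//|nz] := eqVneq (entry e X k l (b - t') ((L j).-1 - t')) 0.
  have ltt' := ltn_ord t'; rewrite -val_eqE /= in neq.
  have := supX _ _ _ _ _ _ _ _ nz => /(_ ltac:(lia) ltac:(lia))[sel'|sel'].
    by have := selected_uniq hphi sel sel' => /(_ ltac:(lia)); lia.
  have [ij _ _] := selected_degree hphi sel'.
  have Dij : i = j by apply: ord_inj; lia.
  subst j; have := selected_uniq hphi sel sel' => /(_ ltac:(lia)) xt'.
  by case: nij; [rewrite eqxx|lia].
have [ij|nij] := eqVneq i j; last first.
  by rewrite big1 ?addr0 // => t' neq; apply: only => //; left.
(* The mirror of the selected pair has index [x] in the sum, so the pair is its own mirror exactly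
   when [t = x]. *)
subst j; have [tx|ntx] := eqVneq t x.
  rewrite big1 ?addr0 // => t' neq; apply: only => //; right.
  by rewrite -tx; rewrite -val_eqE in neq.
have lt_x : (x < (minn b (L i).-1).+1)%N by lia.
rewrite (bigD1 (Ordinal lt_x)) /=; last by rewrite -val_eqE /= eq_sym.
rewrite big1 ?addr0 => [|t' /andP[neq neqx]]; last first.
  by apply: only => //; right; rewrite -val_eqE in neqx.
have -> : entry e X k l (b - x) ((L i).-1 - x) = entry e X k l x y.
  rewrite (sp_entry he k l spX); try lia.
  have -> : (L i - ((L i).-1 - x).+1)%N = x by lia.
  have -> : (L i - (b - x).+1)%N = y by lia.
  rewrite (symX _ k l x y) //; congr (_ * _); apply: eq_sign; lia.
by rewrite -mulr2n => /eqP; rewrite mulrn_eq0 /= => /eqP.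
Qed.

Lemma N_bracket_eq0 X W : N_ sigma e phi X -> X = lie delta W -> X = 0.
Proof.
move=> NX XW; have [spX _ supX _] := (N_entry he hphi X).1 NX.
apply: (entry_ext hb) => i j k l x y ltx lty; rewrite entry0.
have [//|nz] := eqVneq (entry e X k l x y) 0.
case: (supX _ _ _ _ _ _ ltx lty nz) => sel.
  exact: (selected_entry_bracket _ _ NX XW sel).
by rewrite (sp_entry he) // (selected_entry_bracket _ _ NX XW sel) mulr0.
Qed.

(** A selected pair of degree 0 would need rows of equal length, hence [i = j] and [x = y], but
    selected pairs within a row have [x < y]. *)
Lemma N_degree0 X : N_ sigma e phi X -> g_ sigma e 0 X -> X = 0.
Proof.
move=> /(N_entry he hphi)[_ _ supX _] /(g_entry he)[_ gX].
apply: (entry_ext hb) => i j k l x y ltx lty; rewrite entry0.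
have [//|nz] := eqVneq (entry e X k l x y) 0.
have degE := gX _ _ _ _ _ _ ltx lty nz.
case: (supX _ _ _ _ _ _ ltx lty nz) => /(selected_degree hphi)[/(lt_row_p hp) ji lt ij].
  have pij : p i = p j by lia.
  by have := ij (p_inj hp pij); lia.
have pij : p j = p i by lia.
by have := ij (p_inj hp pij); lia.
Qed.

End Uniqueness.

(** * Decomposition of a homogeneous element modulo brackets with [delta] *)

Section Existence.
Variables (R : realType) (s : nat) (p r : 'I_s -> nat) (V : vectType R).
Hypothesis hp : forall i j : 'I_s, (i < j)%N -> (p j < p i)%N.
Variables (sigma : {skew_symmetric V}).
Variable e : forall a : box p, 'I_(r (brow a)) -> V.
Hypothesis he : darboux_basis sigma e.
Let hb : basis_of {:V} [seq e (tagged z) | z : {a : box p & 'I_(r (brow a))}].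
Proof. by case: he. Qed.
Variable delta : 'End(V).
Hypothesis hdelta : is_delta e delta.
Variable phi : box p -> box p -> box p * box p.
Hypothesis hphi : is_assignment phi.
Implicit Types (X Y W : 'End(V)).

Local Notation L i := (2 * p i)%N.
Local Notation family := (forall i j : 'I_s, 'I_(r i) -> 'I_(r j) -> nat -> nat -> R).

(* Weights of the blocks, such that an element X of sp is the sum of its weighted
   part and of the mirror image of the latter. *)
Definition block_weight (i j : 'I_s) : R :=
  if (j < i)%N then 1 else if i == j then 2^-1 else 0.

Lemma block_weightD i j : block_weight i j + block_weight j i = 1.
Proof.
rewrite /block_weight [j == i]eq_sym -val_eqE /=.
by case: ltngtP => _; rewrite ?addr0 ?add0r //; lra.
Qed.

(** The involution on families of entries whose fixed points are the elements of [sp]. *)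
Definition mirrored (A : family) : family := fun i j k l x y =>
  mirror_sign R p i j x y * A j i l k (L j - y.+1)%N (L i - x.+1)%N.

Lemma mirror_signK i j x y : (x < L i)%N -> (y < L j)%N ->
  mirror_sign R p i j x y * mirror_sign R p j i (L j - y.+1) (L i - x.+1) = 1.
Proof.
by move=> ltx lty; rewrite -exprD -[RHS](expr0 (-1)); apply: eq_sign; lia.
Qed.

Lemma symmetrized_sp X (A : family) :
  (forall i j k l x y, (x < L i)%N -> (y < L j)%N ->
     entry e X k l x y = A i j k l x y + mirrored A k l x y) -> sp sigma X.
Proof.
move=> XA; apply: (entry_sp he) => i j k l x y ltx lty.
rewrite !XA; try lia.
rewrite mulrDr addrC /mirrored; congr (_ + _).
have -> : (L i - (L i - x.+1).+1)%N = x by lia.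
have -> : (L j - (L j - y.+1).+1)%N = y by lia.
by rewrite mulrA mirror_signK // mul1r.
Qed.

Lemma mirrored_degree (A : family) (n : nat) :
  (forall i j (k : 'I_(r i)) (l : 'I_(r j)) x y, (x < L i)%N -> (y < L j)%N ->
    A i j k l x y != 0 -> (p i + y = p j + x + n)%N) ->
  forall i j (k : 'I_(r i)) (l : 'I_(r j)) x y, (x < L i)%N -> (y < L j)%N ->
    A i j k l x y + mirrored A k l x y != 0 -> (p i + y = p j + x + n)%N.
Proof.
move=> An i j k l x y ltx lty; have [A0|nz _] := eqVneq (A i j k l x y) 0; last exact: An nz.
rewrite A0 add0r mulf_eq0 signr_eq0 /= => /An - /(_ ltac:(lia) ltac:(lia)); lia.
Qed.

Lemma diag_sum_neq0 (a : nat -> nat -> R) x y : diag_sum a x y != 0 ->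
  exists t, [/\ (t <= x)%N, (t <= y)%N & a (x - t)%N (y - t)%N != 0].
Proof.
move=> nz; apply/not_existsP => no; case/eqP: nz; apply: big1 => t _.
have [//|nz] := eqVneq (a (x - t)%N (y - t)%N) 0; case: (no t); have := ltn_ord t; split=> //; lia.
Qed.

(** The weighted part of X minus [B] has vanishing sums along the diagonals ending in the last
    column, so [antishift] inverts the bracket on it. Adding mirror images brings both [B] and the
    preimage into [sp]. *)
Lemma bracket_decomposition (n : nat) X (B : family) : g_ sigma e n%:Z X ->
  (forall i j (k : 'I_(r i)) (l : 'I_(r j)) x y, (x < L i)%N -> (y < L j)%N ->
    B i j k l x y != 0 -> (p i + y = p j + x + n)%N) ->
  (forall i j (k : 'I_(r i)) (l : 'I_(r j)) x y, (i < j)%N -> B i j k l x y = 0) ->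
  (forall i j (k : 'I_(r i)) (l : 'I_(r j)) b, (j <= i)%N -> (b < L i)%N ->
    diag_sum (B i j k l) b (L j).-1 =
      block_weight i j * diag_sum (entry e X k l) b (L j).-1) ->
  exists Y W, [/\ forall i j k l x y, (x < L i)%N -> (y < L j)%N ->
      entry e Y k l x y = B i j k l x y + mirrored B k l x y,
    g_ sigma e n.+1%:Z W & X = Y + lie delta W].
Proof.
move=> /(g_entry he)[spX Xn] Bn Blt BX.
have [Y DY] := entry_hom hb (fun i j k l x y => B i j k l x y + mirrored B k l x y).
pose D : family := fun i j k l x y => block_weight i j * entry e X k l x y - B i j k l x y.
pose C : family := fun i j k l x y => if (j <= i)%N then antishift (D i j k l) x y else 0.
have [W DW] := entry_hom hb (fun i j k l x y => C i j k l x y + mirrored C k l x y).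
exists Y, W; split=> //.
  apply/(g_entry he); split; first exact: symmetrized_sp DW.
  move=> i j k l x y ltx lty; rewrite DW // => nz.
  suff : (p i + y = p j + x + n.+1)%N by lia.
  apply: (mirrored_degree (A := C)) nz => // {ltx lty} {}i {}j {}k {}l {}x {}y ltx lty.
  rewrite /C; case: ifP => [_|]; last by rewrite eqxx.
  (* [antishift] moves entries of degree [n] one column to the right, which raises the degree by
     one. *)
  case: y lty => [|y] lty /=; first by rewrite eqxx.
  rewrite oppr_eq0 => /diag_sum_neq0[t [tx ty]].
  rewrite /D; have [->|nzX] := eqVneq (entry e X k l (x - t) (y - t)) 0.
    by rewrite mulr0 sub0r oppr_eq0 => /Bn - /(_ ltac:(lia) ltac:(lia)); lia.
  by have := Xn _ _ _ _ _ _ _ _ nzX => /(_ ltac:(lia) ltac:(lia)); lia.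
apply: (entry_ext hb) => i j k l x y ltx lty; rewrite entryD DY // (entry_lie he hdelta) //.
have DC i' j' (k' : 'I_(r i')) (l' : 'I_(r j')) x' y' : (x' < L i')%N -> (y' < L j')%N ->
    shift_br (L j') (C i' j' k' l') x' y' =
      block_weight i' j' * entry e X k' l' x' y' - B i' j' k' l' x' y'.
  move=> ltx' lty'; have [ji|ij] := leqP j' i'; last first.
    rewrite Blt // /block_weight ltnNge (ltnW ij) /= -val_eqE /= ltn_eqF // mul0r subr0.
    by rewrite /shift_br /C leqNgt ij /= if_same; case: x' {ltx'} => [|x']; rewrite subr0.
  rewrite -/(D i' j' k' l' x' y') -(@shift_br_antishift _ (L i') (L j') (D i' j' k' l')) //.
    by rewrite /shift_br /C ji.
  move=> b ltb; rewrite /diag_sum sumrB -mulr_sumr -!/(diag_sum _ _ _) BX //.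
  by rewrite subrr.
rewrite (@eq_shift_br _ (L i) (L j) _ (fun x y => C i j k l x y + mirrored C k l x y)) //; last first.
  by move=> ? ? ? ?; rewrite DW.
have -> : shift_br (L j) (fun x y => C i j k l x y + mirrored C k l x y) x y =
    shift_br (L j) (C i j k l) x y + shift_br (L j) (mirrored C k l) x y.
  rewrite /shift_br; case: x {ltx} => [|x]; case: ifP => _; rewrite ?subr0 ?addr0 ?sub0r -?opprD //.
  by rewrite opprD addrACA.
rewrite DC // /mirrored /mirror_sign (@shift_br_mirror _ (L i)) // DC; try lia.
(* By [sp_entry] the mirrored weighted part is again the entry of X, now with weight
   [block_weight j i]; the two weights add up to 1. *)
rewrite -/(mirror_sign R p i j x y) mulrBr mulrCA -(sp_entry he k l spX) //.
rewrite -{1}[entry e X k l x y]mul1r -(block_weightD i j); ring.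
Qed.

Lemma g_lie (n : nat) W : g_ sigma e n.+1%:Z W -> g_ sigma e n%:Z (lie delta W).
Proof.
move=> /(g_entry he)[spW Wn]; apply/(g_entry he); split.
  apply: (entry_sp he) => i j k l x y ltx lty; rewrite !(entry_lie he hdelta) //; try lia.
  rewrite /mirror_sign -(@shift_br_mirror _ (L i) (L j)) //.
  by apply: (@eq_shift_br _ (L i)) => // *; rewrite (sp_entry he).
move=> i j k l x y ltx lty /(entry_lie_neq0 he hdelta ltx lty).
by move=> [x' [y' [ltx' lty' /(Wn _ _ _ _ _ _ ltx' lty')]]]; lia.
Qed.

Lemma g0_decomposition X : g_ sigma e 0 X ->
  exists Y W, [/\ u_ sigma e delta 0 Y, g_ sigma e 1 W & X = Y + lie delta W].
Proof.
move=> gX; have [spX X0] := (g_entry he _ _).1 gX.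
(* Half of the main diagonal sum of a diagonal block is spread evenly over the [L j] positions,
   which yields a constant diagonal; the mirror image supplies the other half. *)
pose B : family := fun i j k l x y => if (i == j) && (x == y) then
  block_weight i j * diag_sum (entry e X k l) (L j).-1 (L j).-1 / (L j)%:R else 0.
have B0 i j (k : 'I_(r i)) (l : 'I_(r j)) x y : (x < L i)%N -> (y < L j)%N ->
    B i j k l x y != 0 -> (p i + y = p j + x + 0)%N.
  rewrite /B; case: (i =P j) => [ij|_]; last by rewrite eqxx.
  by subst j; case: (x =P y) => [-> _|_]; [rewrite addn0|rewrite eqxx].
have [||Y [W [DY gW XYW]]] := @bracket_decomposition 0 X B gX B0.
- by move=> i j k l x y ij; rewrite /B -val_eqE /= ltn_eqF.
- move=> i j k l b ji ltb; have lepp := lt_row_p hp ji.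
  have [/andP[/eqP ij /eqP Db]|nd] := boolP ((i == j) && (b == (L j).-1)).
    subst j; rewrite -Db {1}/diag_sum minnn.
    under eq_bigr do rewrite /B !eqxx /= -Db.
    rewrite sumr_const card_ord -[_ *+ b.+1]mulr_natr (_ : L i = b.+1)%N; last by lia.
    by rewrite mulfVK // pnatr_eq0.
  have nab t : (t <= b)%N -> (t <= (L j).-1)%N -> (b - t == (L j).-1 - t)%N -> i != j.
    by move=> tb tL bL; apply: contraNneq nd => ij; rewrite ij eqxx /=; lia.
  (* With [j <= i], an entry of degree 0 on a diagonal reaching the last column forces [p i = p j],
     hence the main diagonal of a diagonal block, which is excluded here. *)
  rewrite [RHS](_ : _ = 0); last first.
    apply/eqP; rewrite mulf_eq0; apply/orP; right; apply: contraTT isT => /diag_sum_neq0.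
    move=> [t [tb tL /X0 - /(_ ltac:(lia) ltac:(lia)) degE]].
    have pij : p i = p j by lia.
    have ij := p_inj hp pij; have := nab t tb tL; rewrite ij eqxx; lia.
  apply/eqP; apply: contraTT isT => /diag_sum_neq0[t [tb tL]]; rewrite /B.
  case: (i =P j) => [ij|_]; last by rewrite eqxx.
  case: (_ =P ((L j).-1 - t)%N) => [/eqP/(nab _ tb tL)/eqP/(_ ij) //|_].
  by rewrite eqxx.
exists Y, W; split=> //; split.
  apply/(g_entry he); split; first exact: symmetrized_sp DY.
  move=> i j k l x y ltx lty; rewrite DY // => /(mirrored_degree B0) -/(_ ltx lty); lia.
rewrite lieN; apply/eqP; rewrite oppr_eq0; apply/eqP; apply: (entry_ext hb).
move=> i j k l x y ltx lty; rewrite entry0 (entry_lie he hdelta) //.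
(* On a main diagonal the mirror sign is -1, so Y is the constant [c] there and commutes with the
   shift. *)
pose c := B i j k l 0%N 0%N - B j i l k 0%N 0%N.
rewrite (@eq_shift_br _ (L i) _ _ (fun x y => if x == y then c else 0)) //; last first.
  move=> x' y' ltx' lty'; rewrite DY // /mirrored /mirror_sign /c /B /=.
  have [ij|nij] := eqVneq i j; last first.
    have nji : j != i by rewrite eq_sym.
    by rewrite ?(negPf nij) ?(negPf nji) /= mulr0 subrr addr0 if_same.
  subst j; rewrite eqxx /= (_ : (_ == _) = (x' == y')); last by lia.
  case: eqP => [->|_]; last by rewrite mulr0 addr0.
  by rewrite (@eq_sign _ _ 1) ?mulN1r //; lia.
have [ij|nij] := eqVneq i j; last first.
  have nji : j != i by rewrite eq_sym.
  rewrite /c /B (negPf nij) (negPf nji) /= subrr /shift_br.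
  by case: x {ltx} => [|x]; rewrite !if_same subrr.
subst j; rewrite /shift_br; case: x ltx => [|x] ltx; first by rewrite sub0r if_same oppr0.
rewrite eqSS; case: ltnP => leyi; first by rewrite subrr.
by rewrite subr0 ifF //; lia.
Qed.

(** Within a diagonal block the mirror reflection maps each diagonal to itself, reversed, with the
    constant sign [(-1) ^+ b]. This is the source of the parity condition in [N_]. *)
Lemma diag_sum_entry_transpose X i (k l : 'I_(r i)) b : sp sigma X -> (b < L i)%N ->
  diag_sum (entry e X k l) b (L i).-1 = (-1) ^+ b * diag_sum (entry e X l k) b (L i).-1.
Proof.
move=> spX ltb; rewrite /diag_sum (reindex_inj rev_ord_inj) /= mulr_sumr.
have -> : (minn b (L i).-1) = b by lia.
apply: eq_bigr => t _; have ltt := ltn_ord t; rewrite (sp_entry he k l spX); try lia.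
have -> : (L i - ((L i).-1 - (b.+1 - t.+1)).+1)%N = (b - t)%N by lia.
have -> : (L i - (b - (b.+1 - t.+1)).+1)%N = ((L i).-1 - t)%N by lia.
by congr (_ * _); apply: eq_sign; lia.
Qed.

Lemma g_pos_decomposition (n : nat) X : (0 < n)%N -> g_ sigma e n%:Z X ->
  exists Y W, [/\ N_ sigma e phi Y, g_ sigma e n%:Z Y, g_ sigma e n.+1%:Z W
    & X = Y + lie delta W].
Proof.
move=> n_gt0 gX; have [spX Xn] := (g_entry he _ _).1 gX.
(* The whole weighted sum of a diagonal is put at its selected position; [x + ((L j).-1 - y)] is the
   row in which the diagonal of (x, y) meets the last column. *)
pose B : family := fun i j k l x y => if `[< selected phi i j x y >] then
  block_weight i j * diag_sum (entry e X k l) (x + ((L j).-1 - y)) (L j).-1 else 0.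
have Bsel i j (k : 'I_(r i)) (l : 'I_(r j)) x y : B i j k l x y != 0 -> selected phi i j x y.
  by rewrite /B; case: asboolP => // _; rewrite eqxx.
have sel_range i j x y : selected phi i j x y -> (x + ((L j).-1 - y) < L i)%N /\ (y < L j)%N.
  move=> /(selectedP hphi)[b [x' [rho [y' [<- <- adm phiE]]]]].
  have [t [lr xt yt _]] := assignmentP hphi adm phiE; have := ltn_ord b; have := ltn_ord y'; lia.
have Bn i j (k : 'I_(r i)) (l : 'I_(r j)) x y : (x < L i)%N -> (y < L j)%N ->
    B i j k l x y != 0 -> (p i + y = p j + x + n)%N.
  move=> ltx lty nz; have sel := Bsel _ _ _ _ _ _ nz; move: nz; rewrite /B asboolT //.
  rewrite mulf_eq0 negb_or => /andP[_ /diag_sum_neq0[t [tx ty nz]]].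
  have [ltb _] := sel_range _ _ _ _ sel.
  by have := Xn _ _ _ _ _ _ _ _ nz => /(_ ltac:(lia) ltac:(lia)); lia.
have Bsym i (k l : 'I_(r i)) x y : B i i k l x y = (-1) ^+ (x + y).+1 * B i i l k x y.
  rewrite /B; case: asboolP => [/sel_range[ltb lty]|_]; last by rewrite mulr0.
  rewrite diag_sum_entry_transpose // mulrCA; congr (_ * _); apply: eq_sign; lia.
have [||Y [W [DY gW XYW]]] := @bracket_decomposition n X B gX Bn.
- move=> i j k l x y ij; have [//|/Bsel sel] := eqVneq (B i j k l x y) 0.
  by have [ji _ _] := selected_degree hphi sel; lia.
- move=> i j k l b ji ltb; have lepp := lt_row_p hp ji.
  (* The excluded case [b = rho] is the main diagonal of a diagonal block; it has degree 0, so both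
     sums vanish for positive [n]. *)
  have [/andP[/eqP ij /eqP Db]|nd] := boolP ((i == j) && (b.+1 == L j)).
    subst j; rewrite ![diag_sum _ b _]big1 ?mulr0 // => t _; have ltt := ltn_ord t.
      have [//|nz] := eqVneq (entry e X k l (b - t) ((L i).-1 - t)) 0.
      by have := Xn _ _ _ _ _ _ _ _ nz => /(_ ltac:(lia) ltac:(lia)); lia.
    have [//|nz] := eqVneq (B i i k l (b - t)%N ((L i).-1 - t)%N) 0.
    by have := Bn _ _ _ _ _ _ _ _ nz => /(_ ltac:(lia) ltac:(lia)); lia.
  have [||x [y [t [xt yt sel]]]] := exists_selected hphi ji ltb; first by lia.
    by move=> ij; move: nd; rewrite ij eqxx.
  have lt_t : (t < (minn b (L j).-1).+1)%N by lia.
  rewrite {1}/diag_sum (bigD1 (Ordinal lt_t)) //= big1 ?addr0 => [|t' neq].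
    have -> : (b - t)%N = x by lia.
    have -> : ((L j).-1 - t)%N = y by lia.
    rewrite /B asboolT //; congr (_ * diag_sum _ _ _); lia.
  have ltt' := ltn_ord t'; rewrite -val_eqE /= in neq.
  have [//|/Bsel sel'] := eqVneq (B i j k l (b - t')%N ((L j).-1 - t')%N) 0.
  by have := selected_uniq hphi sel sel' => /(_ ltac:(lia)); lia.
have gY : g_ sigma e n%:Z Y.
  apply/(g_entry he); split; first exact: symmetrized_sp DY.
  move=> i j k l x y ltx lty; rewrite DY // => /(mirrored_degree Bn) -/(_ ltx lty); lia.
exists Y, W; split=> //; apply/(N_entry he hphi); split.
- by case: gY.
- exact: g_nonneg gY.
- move=> i j k l x y ltx lty; rewrite DY //.
  have [->|/Bsel sel _] := eqVneq (B i j k l x y) 0; last by left.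
  by rewrite add0r /mirrored mulf_eq0 negb_or => /andP[_ /Bsel]; right.
move=> i k l x y sel; have [ltx lty] := sel_range _ _ _ _ sel.
have ltx' : (x < L i)%N by lia.
rewrite !DY // mulrDr; congr (_ + _); first exact: Bsym.
rewrite /mirrored mulrCA; congr (_ * _); rewrite Bsym; congr (_ * _); apply: eq_sign; lia.
Qed.

End Existence.

(** * The normalization condition *)

Section NormalizationCondition.
Variables (R : realType) (s : nat) (p r : 'I_s -> nat) (V : vectType R).
Hypothesis hp : forall i j : 'I_s, (i < j)%N -> (p j < p i)%N.
Variables (sigma : {skew_symmetric V}).
Variable e : forall a : box p, 'I_(r (brow a)) -> V.
Hypothesis he : darboux_basis sigma e.
Let hb : basis_of {:V} [seq e (tagged z) | z : {a : box p & 'I_(r (brow a))}].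
Proof. by case: he. Qed.
Variable delta : 'End(V).
Hypothesis hdelta : is_delta e delta.
Variable phi : box p -> box p -> box p * box p.
Hypothesis hphi : is_assignment phi.
Implicit Types (X Y W : 'End(V)).

Local Notation L i := (2 * p i)%N.
Local Notation N := (N_ sigma e phi).
Local Notation g k := (g_ sigma e k).

Lemma g0_mem (k : int) : g k 0.
Proof.
apply/(g_entry he); split; first exact: sp0.
by move=> i j t u x y _ _; rewrite entry0 // eqxx.
Qed.

Lemma u_mem0 k : u_ sigma e delta k 0.
Proof.
have lie0 : lie (0 : 'End(V)) delta = 0 by rewrite /lie comp_lfun0l comp_lfun0r subrr.
by elim: k => [|k IHk]; split; rewrite ?lie0 //; apply: g0_mem.
Qed.

Lemma g_comb (k : int) c X Y : g k X -> g k Y -> g k (c *: X + Y).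
Proof.
move=> /(g_entry he)[spX Xk] /(g_entry he)[spY Yk]; apply/(g_entry he).
split=> [|i j t u x y ltx lty]; first exact: sp_comb.
rewrite entryP //; have [->|/(Xk _ _ _ _ _ _ ltx lty) //] := eqVneq (entry e X t u x y) 0.
by rewrite mulr0 add0r; apply: Yk.
Qed.

Lemma N_subspace : is_subspace N.
Proof.
split.
  apply/(N_entry he hphi); split=> [||i j k l x y _ _|i k l x y _].
  - exact: sp0.
  - by move=> i j k l x y _ _; rewrite entry0 // eqxx.
  - by rewrite entry0 // eqxx.
  - by rewrite !entry0 // mulr0.
move=> c X Y /(N_entry he hphi)[spX X0 supX symX] /(N_entry he hphi)[spY Y0 supY symY].
apply/(N_entry he hphi); split=> [||i j k l x y ltx lty|i k l x y sel].
- exact: sp_comb.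
- move=> i j k l x y ltx lty; rewrite entryP //.
  have [->|/(X0 _ _ _ _ _ _ ltx lty) //] := eqVneq (entry e X k l x y) 0.
  by rewrite mulr0 add0r; apply: Y0.
- rewrite entryP //.
  have [->|/(supX _ _ _ _ _ _ ltx lty) //] := eqVneq (entry e X k l x y) 0.
  by rewrite mulr0 add0r; apply: supY.
- by rewrite !entryP // symX // symY // mulrDr mulrCA.
Qed.

Lemma N_direct_sum : direct_sum N (fun k : nat => N `&` g k%:Z)%classic.
Proof.
split.
  apply/seteqP; split=> [X NX|X [n [f [Nf ->]]]]; last first.
    have [N0 Nc] := N_subspace; elim/big_rec: _ => // k Y _ NY.
    by rewrite -[f k]scale1r; apply: Nc => //; case: (Nf k).
  have [spX X0 supX symX] := (N_entry he hphi X).1 NX.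
  have [f [gf fE [n ->]]] := homogeneous_components he spX X0.
  exists n, f; split=> // k; split=> //; have [spf _] := gf k.
  apply/(N_entry he hphi); split=> // [|i j t u x y ltx lty|i t u x y sel].
  - exact: g_nonneg (gf k).
  - by rewrite fE //; case: ifP => _; [apply: supX|rewrite eqxx].
  - have [x' [y' [_ [_ [Dx Dy _ _]]]]] := sel.
    rewrite !fE -?Dx -?Dy //; case: ifP; rewrite ?mulr0 // => _.
    by apply: symX; rewrite Dx Dy.
move=> n f Nf f0 k ltk; apply: (entry_ext hb) => i j t u x y ltx lty; rewrite entry0 //.
have gf m : g m%:Z (f m) by case: (Nf m).
have := congr1 (fun X => entry e X t u x y) f0; rewrite /= entry_sum // entry0 //.
have [//|nz] := eqVneq (entry e (f k) t u x y) 0.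
rewrite (bigD1 (Ordinal ltk)) //= big1 ?addr0 // => m neq.
have [//|nzm] := eqVneq (entry e (f m) t u x y) 0.
have [_ /(_ _ _ _ _ _ _ ltx lty nz)] := (g_entry he _ _).1 (gf k).
have [_ /(_ _ _ _ _ _ _ ltx lty nzm)] := (g_entry he _ _).1 (gf m).
by move: neq; rewrite -val_eqE /=; lia.
Qed.

Lemma N_complement (k : nat) : direct_sum2 (g k%:Z)
  (addset (u_ sigma e delta k) [set lie delta Y | Y in g k.+1%:Z]%classic)
  (N `&` g k%:Z)%classic.
Proof.
split; apply/seteqP; split=> [X gX|X].
- case: k gX => [|k] gX.
    have [Y [W [uY gW ->]]] := g0_decomposition hp he hdelta gX.
    exists (Y + lie delta W); last exists 0; rewrite ?addr0 //.
      by exists Y => //; exists (lie delta W) => //; exists W.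
    by split; [case: N_subspace|apply: g0_mem].
  have [Y [W [NY gY gW ->]]] := g_pos_decomposition hp he hdelta hphi (ltn0Sn k) gX.
  exists (lie delta W); last by exists Y => //; rewrite addrC.
  exists 0; last by exists (lie delta W); rewrite ?add0r //; exists W.
  exact: u_mem0.
- move=> [_ [U uU [_ [W gW <-] <-]] [Y [NY gY] <-]].
  rewrite -[U + _]scale1r; apply: g_comb gY; rewrite -[U]scale1r; apply: g_comb.
    exact: u_g uU.
  exact: g_lie.
(* In degree 0 already [N_] itself is trivial; in positive degree [U] vanishes, which leaves a
   bracket lying in [N_]. *)
- case: gX => [[U uU [_ [W gW <-] XUW]] [NX gX]] /=; case: k uU gW gX => [|k] uU gW gX.
    exact: (N_degree0 hp he hphi).
  have U0 := u_pos hp he hdelta uU; rewrite U0 add0r in XUW.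
  exact: (N_bracket_eq0 hp he hdelta hphi NX (esym XUW)).
- move=> ->; split; last by split; [case: N_subspace|apply: g0_mem].
  exists 0; first exact: u_mem0.
  exists (lie delta 0); first by exists 0 => //; apply: g0_mem.
  by rewrite /lie comp_lfun0l comp_lfun0r subrr addr0.
Qed.

Lemma N_normalization : normalization_condition sigma e delta N.
Proof.
split.
- exact: N_subspace.
- by move=> X [].
- exact: N_direct_sum.
- exact: N_complement.
Qed.

End NormalizationCondition.

(** * Exponentials of a nilpotent endomorphism *)

Lemma sum_triangle (W : nmodType) N (F : nat -> nat -> W) :
  (forall m n, (N <= m + n)%N -> F m n = 0) ->
  \sum_(m < N) \sum_(n < N) F m n = \sum_(k < N) \sum_(m < k.+1) F m (k - m)%N.
Proof.
move=> F0; transitivity (\sum_(k < N) \sum_(m < N | (m <= k)%N) F m (k - m)%N); last first.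
  by apply: eq_bigr => k _; rewrite (big_ord_widen N (fun m => F m (k - m)%N) (ltn_ord k)).
rewrite [RHS](exchange_big_dep predT) //=; apply: eq_bigr => m _.
have lem := ltnW (ltn_ord m).
rewrite -[RHS](big_mkord (fun k => (m <= k)%N) (fun k => F m (k - m)%N)).
rewrite -(big_nat_widenl _ _ _ xpredT) //=.
have -> : \sum_(m <= k < N) F m (k - m)%N = \sum_(0 <= n < N - m) F m n.
  by rewrite -{1}[nat_of_ord m]add0n big_addn; apply: eq_bigr => n _; rewrite addnK.
rewrite -(big_mkord xpredT (F m)) (big_cat_nat (n := (N - m)%N)) ?leq_subr //=.
rewrite [X in _ + X]big_nat_cond [X in _ + X]big1 ?addr0 // => n /andP[/andP[le _] _].
by rewrite F0 //; lia.
Qed.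

(** The naturals below [size P] are distinct in R and provide too many roots. *)
Lemma poly_horner_eq0 (R : numDomainType) (P : {poly R}) : (forall t, P.[t] = 0) -> P = 0.
Proof.
move=> P0; apply: (@roots_geq_poly_eq0 _ _ [seq n%:R | n <- iota 0 (size P)]).
- by apply/allP => t _; apply/rootP.
- by rewrite map_inj_uniq ?iota_uniq // => m n /eqP; rewrite eqr_nat => /eqP.
- by rewrite size_map size_iota.
Qed.

Section Exponential.
Variables (R : realType) (V : vectType R) (d : 'End(V)).
Hypothesis nilp : forall n, (\dim {:V} <= n)%N -> lfun_pow n d = 0.
Implicit Types (X : 'End(V)) (t : R).

Local Notation D := (\dim {:V}).
Local Notation G t := (exp_nilp (t *: d)).

Lemma lfun_powD m n : lfun_pow (m + n) d = (lfun_pow m d \o lfun_pow n d)%VF.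
Proof. by elim: m => [|m IHm] /=; rewrite ?comp_lfun1l // IHm comp_lfunA. Qed.

(** One vanishing term is added, so that the terms of index 0 and 1 exist even if V has dimension
    0. *)
Lemma exp_nilpE t : G t = \sum_(n < D.+2) (t ^+ n / n`!%:R) *: lfun_pow n d.
Proof.
rewrite big_ord_recr /= [(d \o _)%VF](nilp (n := D.+1)) // scaler0 addr0.
by apply: eq_bigr => n _; rewrite lfun_powZ scalerA mulrC.
Qed.

Lemma exp_nilpD t u : (G t \o G u)%VF = G (t + u).
Proof.
apply/lfunP => v; rewrite comp_lfunE !exp_nilpE !sum_lfunE.
pose F m n := (t ^+ m / m`!%:R * (u ^+ n / n`!%:R)) *: lfun_pow (m + n) d v.
transitivity (\sum_(m < D.+2) \sum_(n < D.+2) F m n).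
  apply: eq_bigr => m _; rewrite scale_lfunE linear_sum scaler_sumr.
  apply: eq_bigr => n _.
  by rewrite scale_lfunE linearZ /= scalerA /F lfun_powD comp_lfunE.
(* Nilpotency cuts the square of indices down to a triangle, where the binomial formula applies. *)
rewrite sum_triangle => [|m n le]; last first.
  by rewrite /F nilp ?zero_lfunE ?scaler0 //; lia.
apply: eq_bigr => k _; rewrite scale_lfunE /F.
under eq_bigr => m _ do rewrite subnKC -1?ltnS //.
rewrite -scaler_suml; congr (_ *: _); rewrite addrC exprDn mulr_suml.
apply: eq_bigr => m _; have lemk : (m <= k)%N by rewrite -ltnS.
have nzf n : n`!%:R != 0 :> R by rewrite pnatr_eq0 -lt0n fact_gt0.
rewrite -(bin_fact lemk) !natrM -mulr_natr; field.
by rewrite !nzf pnatr_eq0 -lt0n bin_gt0 lemk.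
Qed.

Lemma exp_nilp0 : G 0 = \1%VF.
Proof.
rewrite exp_nilpE big_ord_recl big1 ?addr0 => [|n _].
  by rewrite expr0 fact0 divr1 scale1r.
by rewrite exprS mul0r mul0r scale0r.
Qed.

Lemma exp_nilp_comm t : (G t \o d)%VF = (d \o G t)%VF.
Proof.
apply/lfunP => v; rewrite !comp_lfunE exp_nilpE !sum_lfunE linear_sum.
by apply: eq_bigr => n _; rewrite !scale_lfunE linearZ /= -lfun_powSr /= comp_lfunE.
Qed.

(* The coefficient at t of the polynomial exp(-t d) X exp(t d) is the bracket [X, d]. *)
Lemma exp_conj_derivative (f : {scalar 'End(V)}) X :
  (forall t, f (G (- t) \o X \o G t)%VF = 0) -> f (lie X d) = 0.
Proof.
move=> f0; pose c m n := (-1) ^+ m / m`!%:R / n`!%:R *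
  f (lfun_pow m d \o (X \o lfun_pow n d))%VF.
pose P : {poly R} := \sum_(m < D.+2) \sum_(n < D.+2) c m n *: 'X^(m + n).
have P0 : P = 0.
  apply: poly_horner_eq0 => t; rewrite -[RHS](f0 t) horner_sum.
  have -> : (G (- t) \o X \o G t)%VF = \sum_(m < D.+2) \sum_(n < D.+2)
      ((- t) ^+ m / m`!%:R * (t ^+ n / n`!%:R)) *: (lfun_pow m d \o (X \o lfun_pow n d))%VF.
    apply/lfunP => v; rewrite !comp_lfunE !exp_nilpE !sum_lfunE.
    apply: eq_bigr => m _; rewrite scale_lfunE [in LHS]linear_sum [in LHS]linear_sum scaler_sumr sum_lfunE.
    apply: eq_bigr => n _; rewrite !scale_lfunE !comp_lfunE linearZ /= linearZ /=.
    by rewrite scalerA.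
  rewrite linear_sum; apply: eq_bigr => m _; rewrite horner_sum linear_sum.
  apply: eq_bigr => n _; rewrite linearZ /= hornerZ hornerXn /c exprD [(- t) ^+ m]exprNn /=; ring.
have := congr1 (fun P : {poly R} => P`_1) P0; rewrite coef0 coef_sum.
have cE m : (\sum_(n < D.+2) c m n *: 'X^(m + n))`_1 =
    \sum_(n < D.+2) c m n * (m + n == 1)%N%:R.
  by rewrite coef_sum; apply: eq_bigr => n _; rewrite coefZ coefXn eq_sym.
under eq_bigr => m _ do rewrite cE.
(* Only the index pairs (0, 1) and (1, 0) contribute to the coefficient at t. *)
have c0 : \sum_(n < D.+2) c 0%N n * (0 + n == 1)%N%:R = c 0%N 1%N.
  by rewrite 2!big_ord_recl big1 => [|n _] /=; rewrite !(mulr0, mulr1, add0r, addr0).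
have c1 : \sum_(n < D.+2) c 1%N n * (1 + n == 1)%N%:R = c 1%N 0%N.
  by rewrite big_ord_recl big1 => [|n _] /=; rewrite !(mulr0, mulr1, add0r, addr0).
rewrite 2!big_ord_recl /= c0 c1 big1 ?addr0 => [|m _]; last first.
  by apply: big1 => n _; rewrite mulr0.
rewrite /c expr0 expr1 fact0 !divr1 mul1r mulN1r -linearN -linearD => f1.
rewrite -[RHS]f1; congr (f _); rewrite /lie /=.
by rewrite !comp_lfun1l !comp_lfun1r.
Qed.

End Exponential.

(** * Symmetries of the flat curve and invariance of [N_] *)

Section Invariance.
Variables (R : realType) (s : nat) (p r : 'I_s -> nat) (V : vectType R).
Hypothesis hp : forall i j : 'I_s, (i < j)%N -> (p j < p i)%N.
Hypothesis hp1 : forall i : 'I_s, (1 <= p i)%N.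
Hypothesis hr1 : forall i : 'I_s, (1 <= r i)%N.
Variables (sigma : {skew_symmetric V}).
Variable e : forall a : box p, 'I_(r (brow a)) -> V.
Hypothesis he : darboux_basis sigma e.
Let hb : basis_of {:V} [seq e (tagged z) | z : {a : box p & 'I_(r (brow a))}].
Proof. by case: he. Qed.
Variable delta : 'End(V).
Hypothesis hdelta : is_delta e delta.
Variable phi : box p -> box p -> box p * box p.
Hypothesis hphi : is_assignment phi.
Implicit Types (A X Y W : 'End(V)).

Local Notation L i := (2 * p i)%N.
Local Notation G t := (exp_nilp (t *: delta)).

Let nilp n : (\dim {:V} <= n)%N -> lfun_pow n delta = 0.
Proof. exact: delta_nilpotent hr1 he hdelta. Qed.

(** A linear condition, so that it also makes sense for the bracket of a symmetry with [delta],
    which need not be a symmetry. *)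
Definition flag_stable A := forall t, nonneg_degree e (G (- t) \o A \o G t)%VF.

Lemma Sym_ne_flag_stable A : Sym_ne sigma e delta A -> flag_stable A.
Proof.
move=> [_ AG] t; apply: (entry_Vge he) => j.
rewrite -comp_lfunA limg_comp AG -limg_comp exp_nilpD // addNr exp_nilp0 //.
by rewrite lim1g.
Qed.

(** Conjugating [Q] at time [u] amounts to conjugating A at time [t + u]. An entry of negative
    degree thus vanishes for all [u], and so does its derivative at [u = 0], the same entry of the
    bracket of [Q] with [delta]. *)
Lemma flag_stable_lie A : flag_stable A -> flag_stable (lie A delta).
Proof.
move=> AG t; pose Q := (G (- t) \o A \o G t)%VF.
have -> : (G (- t) \o lie A delta \o G t)%VF = lie Q delta.
  rewrite /lie /Q comp_lfunDr comp_lfunNr comp_lfunDl comp_lfunNl; congr (_ - _).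
    by rewrite -!comp_lfunA exp_nilp_comm.
  by rewrite !comp_lfunA exp_nilp_comm.
move=> i j k l x y ltx lty; apply: contraNT => nle; apply/eqP.
have ent_scalar : scalar (fun X => entry e X k l x y) by move=> c X Y; apply: entryP.
pose f : {scalar 'End(V)} := HB.pack (fun X => entry e X k l x y)
  (GRing.isLinear.Build R 'End(V) R _ _ ent_scalar).
apply: (exp_conj_derivative nilp (f := f)) => u /=; apply/eqP; apply: contraNT nle.
have -> : (G (- u) \o Q \o G u)%VF = (G (- (t + u)) \o A \o G (t + u))%VF.
  rewrite /Q !comp_lfunA exp_nilpD // -!comp_lfunA exp_nilpD //.
  by rewrite addrC -opprD addrC.
exact: AG.
Qed.

Lemma Sym_ne_centralizes A : Sym_ne sigma e delta A ->
  nonneg_degree e A /\ lie delta A = 0.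
Proof.
have stable0 X : flag_stable X -> nonneg_degree e X.
  by move/(_ 0); rewrite oppr0 exp_nilp0 // comp_lfun1l comp_lfun1r.
move=> /Sym_ne_flag_stable AG; split; first exact: stable0.
exact: (ad_stable_centralizer hp he hdelta stable0 flag_stable_lie AG).
Qed.

Definition diag_block A i : 'M[R]_(r i) := \matrix_(k, l) entry e A k l 0%N 0%N.

Lemma Sym_ne_row_vec A i x (l : 'I_(r i)) : Sym_ne sigma e delta A -> (x < L i)%N ->
  A (row_vec e x l) = \sum_k diag_block A i k l *: row_vec e x k.
Proof.
move=> /Sym_ne_centralizes[A0 dA] ltx; apply: (row_coord_ext hb) => j y t lty.
rewrite linear_sum -/(entry e A t l y x).
under eq_bigr => k _ do rewrite linearZ /= row_coord_vec // mxE.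
have [ji|nji] := eqVneq j i; last first.
  rewrite big1 => [|k _]; last by rewrite mulr0.
  have [//|nz] := eqVneq (entry e A t l y x) 0.
  by have [ji _] := entry_centralizer hp he hdelta A0 dA lty ltx nz; rewrite ji eqxx in nji.
subst j; have [yx|nyx] := eqVneq y x; last first.
  rewrite big1 => [|k _]; last by rewrite mulr0.
  have [//|nz] := eqVneq (entry e A t l y x) 0.
  by have [_ yx] := entry_centralizer hp he hdelta A0 dA lty ltx nz; rewrite yx eqxx in nyx.
subst y; rewrite (entry_centralizer_diag he hdelta t l dA ltx) (bigD1 t) //= eqxx mulr1.
rewrite big1 ?addr0 // => k neq; by rewrite val_eqE eq_sym (negPf neq) mulr0.
Qed.

(** [sigma] pairs the first and the last tuple of a row by a sign times the Kronecker symbol, and A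
    acts on both by the same matrix. *)
Lemma diag_block_orthogonal A i : Sym_ne sigma e delta A ->
  (diag_block A i)^T *m diag_block A i = 1%:M.
Proof.
move=> symA; apply/matrixP => l l'; rewrite mxE [RHS]mxE.
have lt0 : (0 < L i)%N by have := hp1 i; lia.
have lt1 : ((L i).-1 < L i)%N by lia.
have := proj1 symA (row_vec e 0 l) (row_vec e (L i).-1 l').
rewrite !Sym_ne_row_vec // (sigma_row_vec he) // add0n prednK // !eqxx /=.
set C := diag_block A i; set kappa := (-1) ^+ _.
have -> : sigma (\sum_k C k l *: row_vec e 0 k) (\sum_k C k l' *: row_vec e (L i).-1 k) =
    \sum_k C k l * C k l' * kappa.
  rewrite linear_sumlz; apply: eq_bigr => k _.
  rewrite linearZl_LR linear_sumr (bigD1 k) //= big1 => [|k' neq]; last first.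
    rewrite linearZr_LR /= (sigma_row_vec he) // val_eqE [k == k']eq_sym (negPf neq).
    by rewrite !andbF mul0r mulr0.
  by rewrite linearZr_LR /= (sigma_row_vec he) // add0n prednK // !eqxx mul1r addr0 mulrA.
rewrite -mulr_suml => /(mulIf _) -/(_ (negbT (signr_eq0 _ _))) <-.
by apply: eq_bigr => k _; rewrite !mxE.
Qed.


Lemma Sym_ne_inverse A : Sym_ne sigma e delta A ->
  (A \o A^-1)%VF = \1%VF /\
  forall i x (l : 'I_(r i)), (x < L i)%N ->
    A^-1%VF (row_vec e x l) = \sum_k diag_block A i l k *: row_vec e x k.
Proof.
move=> symA; have [A' DA'] := row_vec_hom hb
  (fun i x l => \sum_k diag_block A i l k *: row_vec e x k).
have AA' : (A \o A')%VF = \1%VF.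
  apply: (row_vec_ext hb) => i x l ltx; rewrite comp_lfunE id_lfunE DA' // linear_sum.
  under eq_bigr => k _ do rewrite linearZ /= Sym_ne_row_vec // scaler_sumr.
  rewrite exchange_big (bigD1 l) //= [X in X + _](_ : _ = row_vec e x l); last first.
    under eq_bigr => k _ do rewrite scalerA.
    rewrite -scaler_suml; have /matrixP/(_ l l) := mulmx1C (diag_block_orthogonal i symA).
    rewrite !mxE eqxx; under eq_bigr => k _ do rewrite [_^T k l]mxE.
    by move=> ->; rewrite scale1r.
  rewrite big1 ?addr0 // => k neq; under eq_bigr => k' _ do rewrite scalerA.
  rewrite -scaler_suml; have /matrixP/(_ l k) := mulmx1C (diag_block_orthogonal i symA).
  rewrite !mxE eq_sym (negPf neq); under eq_bigr => k' _ do rewrite [_^T k' k]mxE.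
  by move=> ->; rewrite scale0r.
have A'A : (A' \o A)%VF = \1%VF.
  apply: (row_vec_ext hb) => i x l ltx; rewrite comp_lfunE id_lfunE Sym_ne_row_vec // linear_sum.
  under eq_bigr => k _ do rewrite linearZ /= DA' // scaler_sumr.
  rewrite exchange_big (bigD1 l) //= [X in X + _](_ : _ = row_vec e x l); last first.
    under eq_bigr => k _ do rewrite scalerA.
    rewrite -scaler_suml; have /matrixP/(_ l l) := diag_block_orthogonal i symA.
    rewrite !mxE eqxx; under eq_bigr => k _ do rewrite [_^T l k]mxE.
    by move=> ->; rewrite scale1r.
  rewrite big1 ?addr0 // => k neq; under eq_bigr => k' _ do rewrite scalerA.
  rewrite -scaler_suml; have /matrixP/(_ l k) := diag_block_orthogonal i symA.
  rewrite !mxE eq_sym (negPf neq); under eq_bigr => k' _ do rewrite [_^T l k']mxE.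
  by move=> ->; rewrite scale0r.
(* The inverse in ['End(V)] is a true inverse only on injective maps; with a zero kernel it is
   identified with [A']. *)
have kerA : lker A == 0%VS.
  by apply/lker0P/(can_inj (g := A')) => v; rewrite -comp_lfunE A'A id_lfunE.
suff -> : (A^-1)%VF = A' by [].
by rewrite -[RHS](lker0_compKf kerA) AA' comp_lfun1r.
Qed.

Lemma entry_Ad A X i j (k : 'I_(r i)) (l : 'I_(r j)) x y :
  Sym_ne sigma e delta A -> (x < L i)%N -> (y < L j)%N ->
  entry e (A \o X \o A^-1)%VF k l x y =
    \sum_k' \sum_l' diag_block A i k k' * diag_block A j l l' * entry e X k' l' x y.
Proof.
move=> symA ltx lty; have [_ AV] := Sym_ne_inverse symA.
have rowA v : row_coord e x k (A v) = \sum_k' diag_block A i k k' * row_coord e x k' v.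
  have Gscal : scalar (fun v => \sum_k' diag_block A i k k' * row_coord e x k' v).
    move=> c u w; rewrite mulr_sumr -big_split /=; apply: eq_bigr => k' _.
    by rewrite linearP mulrDr mulrCA.
  pose G : {scalar V} := HB.pack (fun v => \sum_k' diag_block A i k k' * row_coord e x k' v)
    (GRing.isLinear.Build R V R _ _ Gscal).
  pose F : {scalar V} := row_coord e x k \o A.
  apply: (functional_ext he (F := F) (G := G)) => j' y' t lty' /=.
  rewrite Sym_ne_row_vec // linear_sum /=.
  under eq_bigr => k' _ do rewrite linearZ /= row_coord_vec //.
  under [RHS]eq_bigr => k' _ do rewrite row_coord_vec //.
  have [ij|nij] := eqVneq i j'; last by rewrite !big1 // => k' _; rewrite mulr0.
  subst j'; have [xy|nxy] := eqVneq x y'; last by rewrite !big1 // => k' _; rewrite mulr0.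
  rewrite (bigD1 k) //= [RHS](bigD1 t) //= !eqxx !mulr1 !big1 ?addr0 // => k' neq.
    by rewrite val_eqE (negPf neq) mulr0.
  by rewrite val_eqE eq_sym (negPf neq) mulr0.
rewrite /entry !comp_lfunE AV // rowA; apply: eq_bigr => k' _.
rewrite !linear_sum mulr_sumr; apply: eq_bigr => l' _.
by rewrite !linearZ /= mulrA.
Qed.

(** Conjugation acts on every block by left and right multiplication with matrices depending only on
    the rows, so supports and degrees are kept. In a diagonal block it is a congruence, which
    preserves symmetry and skew-symmetry. *)
Lemma N_Ad_invariant : Ad_invariant sigma e delta (N_ sigma e phi).
Proof.
move=> A X symA /(N_entry he hphi)[spX X0 supX symX].
have [AV _] := Sym_ne_inverse symA.
have AVK v : v = A (A^-1%VF v) by rewrite -comp_lfunE AV id_lfunE.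
have entry_neq0 i j (k : 'I_(r i)) (l : 'I_(r j)) x y : (x < L i)%N -> (y < L j)%N ->
    entry e (A \o X \o A^-1)%VF k l x y != 0 ->
    exists k' l', entry e X (i := i) (j := j) k' l' x y != 0.
  move=> ltx lty; rewrite entry_Ad // => nz; apply/not_existsP => no.
  case/eqP: nz; apply: big1 => k' _; apply: big1 => l' _.
  have [->|nz] := eqVneq (entry e X k' l' x y) 0; first by rewrite mulr0.
  by case: (no k'); exists l'.
apply/(N_entry he hphi); split=> [u v||i j k l x y ltx lty|i k l x y sel].
- rewrite !comp_lfunE [in sigma _ v](AVK v) [in sigma u _](AVK u).
  by rewrite !(proj1 symA).
- move=> i j k l x y ltx lty /(entry_neq0 _ _ _ _ _ _ ltx lty)[k' [l']].
  exact: X0.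
- by move=> /(entry_neq0 _ _ _ _ _ _ ltx lty)[k' [l']]; apply: supX.
have [x' [y' [_ [_ [Dx Dy _ _]]]]] := sel.
have ltx : (x < L i)%N by rewrite -Dx.
have lty : (y < L i)%N by rewrite -Dy.
rewrite !entry_Ad // mulr_sumr exchange_big /=; apply: eq_bigr => l' _.
rewrite mulr_sumr; apply: eq_bigr => k' _.
by rewrite symX // [RHS]mulrCA [X in X * _ = _]mulrC.
Qed.

End Invariance.

Theorem theorem3p11 (R : realType) (s : nat) (hs : (0 < s)%N)
    (p r : 'I_s -> nat)
    (hp : forall i j : 'I_s, (i < j)%N -> (p j < p i)%N)
    (hp1 : forall i : 'I_s, (1 <= p i)%N)
    (hr1 : forall i : 'I_s, (1 <= r i)%N)
    (V : vectType R) (sigma : {skew_symmetric V})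
    (hsigma : is_psymplectic sigma)
    (e : forall a : box p, 'I_(r (brow a)) -> V)
    (he : darboux_basis sigma e)
    (delta : 'End(V)) (hdelta : is_delta e delta)
    (phi : box p -> box p -> box p * box p) (hphi : is_assignment phi) :
  normalization_condition sigma e delta (N_ sigma e phi) /\
  Ad_invariant sigma e delta (N_ sigma e phi).
Proof.
split; first exact: N_normalization.
exact: (N_Ad_invariant hp hp1 hr1 he hdelta hphi).
Qed.
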